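(* Let $(M,g)$ be a complete Riemannian manifold and $N\ge1$. If $A\subset M$ has volume zero in $M$, then the set $$\{Q\in M^N:\mathcal B(Q)\cap A\neq\emptyset\}$$ has volume zero in $M^N$.
   Context: Manifolds and metrics are $C^\infty$ and $M$ is connected. For $Q=(q_1,\dots,q_N)\in M^N$, a point $p\in M$ is a barycenter of $Q$ if there exist $v_1,\dots,v_N\in T_pM$ with $\exp_p(v_i)=q_i$ for $1\le i\le N$ and $\sum_i v_i=0$; $\mathcal B(Q)\subset M$ denotes the set of all barycenters of $Q$. (The $v_i$ need not give minimal geodesics.) A subset of an $n$-dimensional manifold has volume zero if its image in every smooth chart has $n$-dimensional Lebesgue measure zero. *)

(* Defs.v *)
From HB Require Import structures.
From mathcomp Require Import all_boot all_order all_algebra.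
From mathcomp Require Import all_classical all_reals all_analysis.
Set Implicit Arguments.
Unset Strict Implicit.
Unset Printing Implicit Defensive.
Import Order.TTheory GRing.Theory Num.Theory.
Import numFieldNormedType.Exports.
Local Open Scope classical_set_scope.
Local Open Scope ring_scope.

(** * Smooth maps between open sets of normed spaces *)

(* [iter_derive [:: v1; ...; vk] f] is D_v1 (... (D_vk f)). *)
Definition iter_derive (R : realType) (V W : normedModType R)
    (s : seq V) (f : V -> W) : V -> W :=
  foldr (fun v h => 'D_v h) f s.

(* C^oo: every iterated directional derivative of [f], of any order, exists and
   is Frechet differentiable (in particular continuous) on [U].  Only meaningful
   for [U] open. *)
Definition smooth_on (R : realType) (V W : normedModType R)
    (U : set V) (f : V -> W) : Prop :=
  forall (s : seq V) (x : V), U x -> differentiable (iter_derive s f) x.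

(** * Lebesgue outer measure on R^m *)

Definition closed_box (R : realType) (m : nat) (a b : 'rV[R]_m) :
    set 'rV[R]_m :=
  [set x | forall j, a ord0 j <= x ord0 j <= b ord0 j].

Definition box_volume (R : realType) (m : nat) (a b : 'rV[R]_m) : R :=
  \prod_(j < m) (b ord0 j - a ord0 j).

(* Infimum of the total volume over the finite or countable covers by closed
   boxes.  The index predicate [P] matters when m = 0, where the only box has
   volume 1: the empty cover is what gives measure 0 to the empty set. *)
Definition lebesgue_outer (R : realType) (m : nat) (X : set 'rV[R]_m) :
    \bar R :=
  ereal_inf [set s : \bar R | exists (P : pred nat) (a b : nat -> 'rV[R]_m),
    [/\ forall k j, a k ord0 j <= b k ord0 j,
        X `<=` \bigcup_(k in [set k | P k]) closed_box (a k) (b k) &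
        s = (\sum_(0 <= k <oo | P k) (box_volume (a k) (b k))%:E)%E]].

(** * Charts, atlases, manifolds *)

(* [chart_map] and [chart_inv] are total functions; only the restriction of
   [chart_map] to [chart_dom] and that of its inverse [chart_inv] to
   [chart_map @` chart_dom] are meaningful. *)
Record chart (R : realType) (T : Type) (m : nat) := Chart {
  chart_dom : set T ;
  chart_map : T -> 'rV[R]_m ;
  chart_inv : 'rV[R]_m -> T }.

Section Manifold.
Context {R : realType} {T : topologicalType} {m : nat}.
Implicit Types (c d : chart R T m) (Atl : set (chart R T m)).

Definition chart_range c : set 'rV[R]_m := chart_map c @` chart_dom c.

Definition is_chart c : Prop :=
  [/\ open (chart_dom c), open (chart_range c),
      forall p, chart_dom c p -> chart_inv c (chart_map c p) = p,
      forall p, chart_dom c p -> {for p, continuous (chart_map c)} &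
      forall x, chart_range c x -> {for x, continuous (chart_inv c)}].

Definition transition c d : 'rV[R]_m -> 'rV[R]_m := chart_map d \o chart_inv c.

Definition smooth_compatible c d : Prop :=
  smooth_on (chart_map c @` (chart_dom c `&` chart_dom d)) (transition c d) /\
  smooth_on (chart_map d @` (chart_dom c `&` chart_dom d)) (transition d c).

Definition smooth_atlas Atl : Prop :=
  [/\ forall c, Atl c -> is_chart c,
      forall p : T, exists2 c, Atl c & chart_dom c p &
      forall c d, Atl c -> Atl d -> smooth_compatible c d].

Definition smooth_manifold Atl : Prop :=
  [/\ hausdorff_space T, @second_countable T & smooth_atlas Atl].

(* Membership in the maximal atlas generated by [Atl]. *)
Definition smooth_chart Atl c : Prop :=
  is_chart c /\ forall d, Atl d -> smooth_compatible c d.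

Definition volume_zero Atl (A : set T) : Prop :=
  forall c, smooth_chart Atl c ->
    lebesgue_outer (chart_map c @` (chart_dom c `&` A)) = 0%E.

End Manifold.

(** * The product manifold M^N *)

(* (R^m)^N is identified with R^(N * m) by [mxvec]. *)
Definition prod_chart (R : realType) (T : Type) (m N : nat)
    (c : 'I_N -> chart R T m) : chart R {ptws 'I_N -> T} (N * m) :=
  {| chart_dom := [set Q | forall i, chart_dom (c i) (Q i)] ;
     chart_map := fun Q => mxvec (\matrix_(i < N) chart_map (c i) (Q i)) ;
     chart_inv := fun y i => chart_inv (c i) (row i (vec_mx y)) |}.

Definition prod_atlas (R : realType) (T : Type) (m N : nat)
    (Atl : set (chart R T m)) : set (chart R {ptws 'I_N -> T} (N * m)) :=
  [set prod_chart c | c in [set c : 'I_N -> chart R T m | forall i, Atl (c i)]].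

(** * Riemannian geometry *)

Section Riemannian.
Context {R : realType} {M : topologicalType} {n : nat}.
Variable Atl : set (chart R M n).
Implicit Types (c d : chart R M n) (p : M).

(* A tangent vector at [p] is the family of its components in the charts of the
   atlas around [p], related by the Jacobians of the transition maps ([jacobian]
   acts on row vectors from the right).  The value 0 at the other indices makes
   the family unique, so that T_p M is a linear subspace of this function
   space. *)
Definition tangent_vector p (v : chart R M n -> 'rV[R]_n) : Prop :=
  (forall c d, Atl c -> Atl d -> chart_dom c p -> chart_dom d p ->
     v d = v c *m jacobian (transition c d) (chart_map c p)) /\
  (forall c, ~ (Atl c /\ chart_dom c p) -> v c = 0).

(* [g c p] is the Gram matrix of the inner product of T_p M in the coordinate
   basis of the chart [c]; it is only meaningful for [Atl c] and
   [chart_dom c p]. *)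
Definition riemannian_metric (g : chart R M n -> M -> 'M[R]_n) : Prop :=
  [/\ forall c p, Atl c -> chart_dom c p -> (g c p)^T = g c p,
      forall c p (v : 'rV[R]_n), Atl c -> chart_dom c p -> v != 0 ->
        0 < (v *m g c p *m v^T) ord0 ord0,
      forall c, Atl c -> smooth_on (chart_range c) (g c \o chart_inv c) &
      forall c d p, Atl c -> Atl d -> chart_dom c p -> chart_dom d p ->
        let J := jacobian (transition c d) (chart_map c p) in
        g c p = J *m g d p *m J^T].

Variable g : chart R M n -> M -> 'M[R]_n.

(* The partial derivative d_i g_jk in the chart [c]. *)
Definition dmetric c (i j k : 'I_n) (x : 'rV[R]_n) : R :=
  'D_(delta_mx ord0 i) (fun y => g c (chart_inv c y) j k) x.

(* Gamma^k_ij *)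
Definition christoffel c (k i j : 'I_n) (x : 'rV[R]_n) : R :=
  2^-1 * \sum_(l < n) invmx (g c (chart_inv c x)) k l *
    (dmetric c i j l x + dmetric c j i l x - dmetric c l i j x).

Definition geodesic (gam : R -> M) : Prop :=
  continuous gam /\
  forall c, Atl c -> let x := chart_map c \o gam in
    smooth_on (gam @^-1` chart_dom c) x /\
    forall t, chart_dom c (gam t) -> forall k,
      derive1n 2 x t ord0 k +
      \sum_(i < n) \sum_(j < n)
        christoffel c k i j (x t) * derive1 x t ord0 i * derive1 x t ord0 j = 0.

Definition velocity (gam : R -> M) (t : R) : chart R M n -> 'rV[R]_n :=
  fun c => if `[< Atl c /\ chart_dom c (gam t) >]
    then derive1 (chart_map c \o gam) t else 0.

Definition geodesic_from p (v : chart R M n -> 'rV[R]_n) (gam : R -> M) :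
    Prop :=
  [/\ geodesic gam, gam 0 = p & velocity gam 0 = v].

Definition geodesically_complete : Prop :=
  forall p v, tangent_vector p v -> exists gam, geodesic_from p v gam.

Definition riem_exp p (v : chart R M n -> 'rV[R]_n) : M :=
  xget p [set gam 1 | gam in geodesic_from p v].

Definition barycenters (N : nat) (Q : 'I_N -> M) : set M :=
  [set p | exists v : 'I_N -> chart R M n -> 'rV[R]_n,
     [/\ forall i, tangent_vector p (v i),
         forall i, riem_exp p (v i) = Q i &
         \sum_(i < N) v i = 0]].

End Riemannian.

(* Main.v *)
Require Import Defs.
From mathcomp Require Import all_boot all_order all_algebra.
From mathcomp Require Import all_classical all_reals all_analysis.
From mathcomp Require Import ring lra.
Set Implicit Arguments.
Unset Strict Implicit.
Unset Printing Implicit Defensive.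
Import Order.TTheory GRing.Theory Num.Theory.
Import numFieldNormedType.Exports.
Local Open Scope classical_set_scope.
Local Open Scope ring_scope.

(** A tuple [Q] of the exceptional set is the tuple of time-1 endpoints of
    geodesics that start at one point [p] of [A] with initial velocities of sum
    zero.  It is therefore determined by [p] and by all but one of the
    velocities, that is by a point of [A * R^(n(N-1))] in a chart.  This set is
    null in [R^(nN)], whose dimension is that of [M^N], so the theorem holds as
    soon as the passage from these initial data to [Q] preserves null sets, and
    a Lipschitz dependence is enough for that.

    Null sets are stable under countable unions, so the dependence may be proved
    Lipschitz only after a partition of the geodesics into countably many
    classes: this is [sigma_lipschitz].  It is a transitive notion, it
    can be checked on each member of a countable cover
    ([sigma_lipschitz_cover]), and it carries null sets to null sets
    ([lebesgue_null_image_sigma_lipschitz]).  What it buys is that two geodesics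
    are compared only when both already exist and follow the same itinerary:
    the same chart, over the same interval of time, inside the same region of
    phase space where the geodesic equation has a given Lipschitz constant.
    Gronwall's inequality then bounds the distance between their states
    (position and velocity) at the end of the interval by a multiple of the
    distance at its beginning ([state_flow_sigma_lipschitz]); a change of chart
    acts on states by a differentiable map, hence in a sigma-Lipschitz way
    ([state_switch_sigma_lipschitz]).

    By compactness of [0, 1] each geodesic satisfies the requirements of such an
    itinerary for a subdivision into finitely many equal intervals
    ([tubular_subdivision]), and there are countably many itineraries because
    the manifold has a countable atlas and phase space can be cut into countably
    many cells of any prescribed size.  Composing along the subdivision gives
    [local_state_sigma_lipschitz]: the state at time 1 is a sigma-Lipschitz
    function of the state at time 0.  Finally, a chart of the maximal atlas of
    [M^N] differs from a product chart by a map differentiable on the overlap,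
    and such maps preserve null sets ([lebesgue_null_image_differentiable]). *)

(** * Norms and neighbourhoods *)

Lemma pair_dist_le {R : realType} {V W : normedModType R} (x y : V * W) (s : R) :
  `|x.1 - y.1| <= s -> `|x.2 - y.2| <= s -> `|x - y| <= s.
Proof. by move=> h1 h2; rewrite prod_normE ge_max; apply/andP. Qed.

Lemma open_near {T : topologicalType} (U : set T) x : open U -> U x -> \forall y \near x, U y.
Proof. by move=> oU Ux; exact: open_nbhs_nbhs. Qed.

(** * Countable coverings *)

Section Coverings.
Context {R : realType}.

(** The same notion serves for boxes and for cubes.  The value [None] stands for
    a missing member of the covering, which has weight 0; a cover by actual sets
    could not do this in dimension 0, where every box has volume 1.  Bounding
    the partial sums keeps the weights in [R]. *)
Definition coverable {T I : Type} (B : I -> set T) (w : I -> R)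
    (X : set T) (e : R) : Prop :=
  exists s : nat -> option I,
    X `<=` \bigcup_k oapp B set0 (s k) /\
    forall k, \sum_(i < k) oapp w 0 (s i) <= e.

(** Transport of coverings along a relation: if each set of the first family,
    followed by [rho], lands in one set of the second family whose weight is at
    most [c] times larger, then so does the whole covering.  A relation is used
    because the maps of interest are Lipschitz only between the values taken on
    one class of geodesics. *)
Lemma coverable_transfer {T I T' I' : Type} (B : I -> set T) (w : I -> R)
    (B' : I' -> set T') (w' : I' -> R) (rho : T -> T' -> Prop) (c : R)
    (X : set T) (Y : set T') (e : R) :
  0 <= c ->
  (forall i, exists o : option I', oapp w' 0 o <= c * w i /\
     forall x y, X x -> Y y -> B i x -> rho x y -> oapp B' set0 o y) ->
  (forall y, Y y -> exists2 x, X x & rho x y) ->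
  coverable B w X e -> coverable B' w' Y (c * e).
Proof.
move=> c0 /choice[t ht] XY [s [Xs se]].
exists (fun k => obind t (s k)); split.
- move=> y Yy; have [x Xx xy] := XY y Yy; have [k _ Bx] := Xs x Xx.
  exists k => //; case: (s k) Bx => //= i Bx.
  by have [_ h] := ht i; exact: (h x).
- move=> k; apply: le_trans (ler_wpM2l c0 (se k)); rewrite mulr_sumr.
  apply: ler_sum => i _; case: (s i) => [j|] /=; last by rewrite mulr0.
  by have [] := ht j.
Qed.

Lemma coverable_sub {T I : Type} (B : I -> set T) w (X Y : set T) (e e' : R) :
  Y `<=` X -> e <= e' -> coverable B w X e -> coverable B w Y e'.
Proof.
move=> YX ee [s [Xs se]]; exists s; split; first exact: subset_trans Xs.
by move=> k; exact: le_trans ee.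
Qed.

Lemma coverable_seq {T : Type} {I : eqType} (B : I -> set T) (w : I -> R) (X : set T)
    (s : seq I) (e : R) :
  (forall i, 0 <= w i) ->
  (forall x, X x -> exists2 i, i \in s & B i x) ->
  \sum_(i <- s) w i <= e -> coverable B w X e.
Proof.
move=> w0 Xs se; exists (onth s); split.
  by move=> x /Xs[i /onthP[k ski] Bx]; exists k => //; rewrite ski.
move=> k; apply: le_trans se.
elim: s k {Xs} => [|i s IH] [|k]; rewrite ?big_nil ?big_ord0 //.
- by rewrite big1// => i _; case: (nat_of_ord i).
- exact: sumr_ge0.
- by rewrite big_ord_recl big_cons /= lerD2l; exact: IH.
Qed.

(** Countable subadditivity: the coverings of the [X k] are merged into a single
    sequence through the encoding of pairs of naturals. *)
Lemma coverable_bigcup {T I : Type} (B : I -> set T) (w : I -> R)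
    (X : nat -> set T) (e : nat -> R) (e' : R) :
  (forall i, 0 <= w i) -> (forall k, 0 <= e k) ->
  (forall k, coverable B w (X k) (e k)) ->
  (forall k, \sum_(i < k) e i <= e') ->
  coverable B w (\bigcup_k X k) e'.
Proof.
move=> w0 e0 /choice[s hs] ee'.
exists (fun m => obind (fun p : nat * nat => s p.1 p.2) (pickle_inv m)); split.
  move=> x [k _ Xx]; have [/(_ x Xx)[l _ Bx] _] := hs k.
  by exists (pickle (k, l)) => //; rewrite pickleK_inv.
have f0 k l : 0 <= oapp w 0 (s k l) by case: (s k l) => /=.
move=> M; pose p (m : nat) : nat * nat := odflt (0%N, 0%N) (pickle_inv m).
pose K := (\max_(m < M) (p m).1).+1; pose L := (\max_(m < M) (p m).2).+1.
(* The first [M] codes only involve pairs below [(K, L)], and each pair has a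
   single code. *)
apply: (@le_trans _ _ (\sum_(m < M) \sum_(k < K) \sum_(l < L)
    if pickle (nat_of_ord k, nat_of_ord l) == m then oapp w 0 (s k l) else 0)).
  apply: ler_sum => m _; case E : (pickle_inv m) => [[k l]|] /=; last first.
    by apply: sumr_ge0 => k _; apply: sumr_ge0 => l _; case: ifP.
  have kK : (k < K)%N.
    by rewrite ltnS; apply: leq_trans (leq_bigmax (F := fun m : 'I_M => (p m).1) m); rewrite /p E.
  have lL : (l < L)%N.
    by rewrite ltnS; apply: leq_trans (leq_bigmax (F := fun m : 'I_M => (p m).2) m); rewrite /p E.
  rewrite (bigD1 (Ordinal kK))//= (bigD1 (Ordinal lL))//=.
  have -> : pickle (k, l) = m by have := pickle_invK (T:=(nat * nat)%type) m; rewrite /oapp E.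
  rewrite eqxx -addrA lerDl addr_ge0//; apply: sumr_ge0 => i _.
    by case: ifP.
  by apply: sumr_ge0 => j _; case: ifP.
apply: le_trans (ee' K); rewrite exchange_big/=; apply: ler_sum => k _.
apply: (@le_trans _ _ (\sum_(l < L) oapp w 0 (s k l))); last by have [] := hs k.
rewrite exchange_big/=; apply: ler_sum => l _.
case: (ltnP (pickle (nat_of_ord k, nat_of_ord l)) M) => [pM|pM].
  rewrite (bigD1 (Ordinal pM))//= eqxx big1 ?addr0// => m mP.
  by rewrite ifN// eq_sym.
rewrite big1// => m _; case: ifP => // /eqP pm.
by move: pM; rewrite pm leqNgt ltn_ord.
Qed.

Lemma sum_half_powers_le (e : R) (k : nat) :
  0 <= e -> \sum_(i < k) e / 2 ^+ i.+1 <= e.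
Proof.
move=> e0; suff -> : \sum_(i < k) e / 2 ^+ i.+1 = e - e / 2 ^+ k.
  by rewrite gerBl divr_ge0// exprn_ge0.
elim: k => [|k IH]; first by rewrite big_ord0 expr0 divr1 subrr.
by rewrite big_ord_recr/= IH exprS; field; rewrite expf_neq0.
Qed.

End Coverings.

(** * Lebesgue null sets of R^m *)

Section NullSets.
Context {R : realType} {m : nat}.
Implicit Types X Y : set 'rV[R]_m.

(** A box is stored as a corner and a vector of sides, read in absolute value:
    every pair then denotes a box of nonnegative volume. *)
Definition box (ad : 'rV[R]_m * 'rV[R]_m) : set 'rV[R]_m :=
  closed_box ad.1 (\row_j (ad.1 ord0 j + `|ad.2 ord0 j|)).
Definition boxvol (ad : 'rV[R]_m * 'rV[R]_m) : R := \prod_(j < m) `|ad.2 ord0 j|.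

Definition cube (xr : 'rV[R]_m * R) : set 'rV[R]_m :=
  [set y | `|y - xr.1| <= `|xr.2|].
Definition cubevol (xr : 'rV[R]_m * R) : R := (2 * `|xr.2|) ^+ m.

Definition lebesgue_null X : Prop := forall e, 0 < e -> coverable box boxvol X e.

Lemma boxvol_ge0 ad : 0 <= boxvol ad.
Proof. by apply: prodr_ge0 => j _. Qed.

Lemma cubevol_ge0 xr : 0 <= cubevol xr.
Proof. by rewrite exprn_ge0// mulr_ge0. Qed.

Lemma row_normP (x : 'rV[R]_m) (r : R) :
  0 <= r -> (`|x| <= r <-> forall j, `|x ord0 j| <= r).
Proof.
move=> r0; rewrite {1}/Num.norm/= mx_normrE; split.
  by move=> /bigmax_leP[_ xr] j; exact: (xr (ord0, j)).
by move=> xr; apply/bigmax_leP; split=> // -[i j] _ /=; rewrite (ord1 i).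
Qed.

Lemma lebesgue_outer_eq0 X : lebesgue_outer X = 0%E <-> lebesgue_null X.
Proof.
have S0 s : [set s : \bar R | exists (P : pred nat) (a b : nat -> 'rV[R]_m),
    [/\ forall k j, a k ord0 j <= b k ord0 j,
        X `<=` \bigcup_(k in [set k | P k]) closed_box (a k) (b k) &
        s = (\sum_(0 <= k <oo | P k) (box_volume (a k) (b k))%:E)%E]] s -> (0 <= s)%E.
  move=> [P [a [b [ab _ ->]]]]; apply: nneseries_ge0 => k _ _.
  by rewrite lee_fin; apply: prodr_ge0 => j _; rewrite subr_ge0.
split=> [X0 e e0|Xnull].
- have : (lebesgue_outer X < e%:E)%E by rewrite X0 lte_fin.
  move=> /ereal_inf_lt[_ [P [a [b [ab XP ->]]]]] se.
  pose s k := if P k then Some (a k, b k - a k) else None.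
  exists s; split.
    move=> x /XP[k /= Pk abx]; exists k => //; rewrite /s Pk/= => j.
    rewrite !mxE/=; have := abx j; have := ab k j => h.
    by rewrite ger0_norm ?subr_ge0// [a k _ _ + _]addrC subrK.
  move=> k; rewrite -lee_fin -sumEFin; apply: le_trans (ltW se).
  rewrite -(big_mkord xpredT (fun i => (oapp boxvol 0 (s i))%:E)).
  apply: le_trans; last first.
    apply: (nneseries_lim_ge k) => i _ _; rewrite lee_fin.
    by apply: prodr_ge0 => j _; rewrite subr_ge0.
  rewrite [leRHS]big_mkcond/=; apply: lee_sum => i _; rewrite /s.
  case: (P i) => //=; rewrite lee_fin; apply: ler_prod => j _.
  by rewrite normr_ge0 !mxE/= ger0_norm// subr_ge0.
- apply/eqP; rewrite eq_le; apply/andP; split; last first.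
    by apply: le_ereal_inf_tmp => s /S0.
  apply/lee_addgt0Pr => e e0; rewrite add0e.
  have [s [Xs se]] := Xnull e e0.
  pose P k := isSome (s k); pose ad k := odflt (0, 0) (s k).
  apply: (@le_trans _ _ (\sum_(0 <= k <oo | P k)
     (box_volume (ad k).1 (\row_j ((ad k).1 ord0 j + `|(ad k).2 ord0 j|)))%:E)%E).
    apply: ereal_inf_lbound; exists P, (fun k => (ad k).1),
      (fun k => \row_j ((ad k).1 ord0 j + `|(ad k).2 ord0 j|)); split=> //.
      by move=> k j; rewrite mxE lerDl.
    move=> x /Xs[k _ h]; exists k => /=; rewrite /P/ad; by case: (s k) h.
  have bv k : box_volume (ad k).1 (\row_j ((ad k).1 ord0 j + `|(ad k).2 ord0 j|)) = boxvol (ad k).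
    by rewrite /box_volume /boxvol; apply: eq_bigr => j _; rewrite mxE addrC addrK.
  have bv0 k : (0 <= k)%N -> P k -> (0 <= (box_volume (ad k).1 (\row_j ((ad k).1 ord0 j + `|(ad k).2 ord0 j|)))%:E)%E.
    by move=> _ _; rewrite bv lee_fin boxvol_ge0.
  apply: (lime_le (is_cvg_nneseries_cond bv0)).
  apply: nearW => k; rewrite big_mkord big_mkcond/=.
  apply: le_trans (_ : _ <= (\sum_(i < k) oapp boxvol 0 (s i))%:E)%E _; last first.
    by rewrite lee_fin.
  rewrite -sumEFin; apply: lee_sum => i _; rewrite bv /P /ad.
  by case: (s i).
Qed.

Lemma lebesgue_null_sub X Y : Y `<=` X -> lebesgue_null X -> lebesgue_null Y.
Proof. by move=> YX Xn e e0; apply: coverable_sub (Xn e e0). Qed.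

Lemma lebesgue_null_bigcup (X : nat -> set 'rV[R]_m) :
  (forall k, lebesgue_null (X k)) -> lebesgue_null (\bigcup_k X k).
Proof.
move=> Xn e e0; apply: (@coverable_bigcup _ _ _ _ _ _ (fun k => e / 2 ^+ k.+1)).
- exact: boxvol_ge0.
- by move=> k; rewrite divr_ge0 ?exprn_ge0// ltW.
- by move=> k; apply: Xn; rewrite divr_gt0// exprn_gt0.
- by move=> k; exact/sum_half_powers_le/ltW.
Qed.

Lemma lebesgue_null_countable_cover (D : countType) (X : D -> set 'rV[R]_m) Y :
  Y `<=` \bigcup_d X d -> (forall d, lebesgue_null (X d)) -> lebesgue_null Y.
Proof.
move=> YX Xn.
apply: (@lebesgue_null_sub (\bigcup_k oapp X set0 (pickle_inv k))).
  by move=> y /YX[d _ Xy]; exists (pickle d) => //; rewrite pickleK_inv.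
apply: lebesgue_null_bigcup => k; case: (pickle_inv k) => [d|] /=; first exact: Xn.
move=> e e0; exists (fun=> None); split=> // n.
by rewrite big1// ltW.
Qed.

(** Counting cubes of side [del] that meet a box amounts to lengthening its sides
    by at most [del]; the volume depends continuously on [del], so this costs
    as little as desired, also for degenerate boxes. *)
Lemma prod_widen_le (d : 'I_m -> R) (e : R) : 0 < e ->
  exists2 del, 0 < del & \prod_(j < m) (d j + del) <= \prod_(j < m) d j + e.
Proof.
move=> e0; pose p := \prod_(j < m) ((d j)%:P + 'X) : {poly R}.
have pE x : p.[x] = \prod_(j < m) (d j + x).
  by rewrite horner_prod; apply: eq_bigr => j _; rewrite !hornerE.
have := @continuous_horner _ p 0.
move=> /cvgrPdist_le /(_ e e0) [/= del del0 h].
exists (del / 2); first by rewrite divr_gt0.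
have := h (del / 2); rewrite /ball_/= sub0r normrN gtr0_norm ?divr_gt0//.
rewrite ltr_pdivrMr// ltr_pMr// ltr1n => /(_ isT).
rewrite !pE ler_distlC => /andP[_].
have -> : \prod_(j < m) (d j + 0) = \prod_(j < m) d j.
  by apply: eq_bigr => j _; rewrite addr0.
exact.
Qed.

(** A regular grid of step [del] covers the box with [K j] steps in direction
    [j], and [K j * del] is at most the [j]-th side plus [del]. *)
Lemma box_coverable_cubes (ad : 'rV[R]_m * 'rV[R]_m) (e : R) :
  0 < e -> coverable cube cubevol (box ad) (boxvol ad + e).
Proof.
move=> e0; case: ad => a d; pose D j := `|d ord0 j|.
have [del del0 hdel] := prod_widen_le D e0.
pose K j := (Num.truncn (D j / del)).+1; pose Kmax := \max_j K j.
(* Cells of the grid are indexed by functions into one ordinal type, restricted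
   to [K j] values in direction [j]. *)
pose F (j : 'I_m) : pred 'I_Kmax := fun i => (i < K j)%N.
pose cube_of (f : {ffun 'I_m -> 'I_Kmax}) : 'rV[R]_m * R :=
  (\row_j (a ord0 j + ((f j)%:R + 2^-1) * del), del / 2).
have Dd j : 0 <= D j / del by apply: divr_ge0; [exact: normr_ge0|exact: ltW].
apply: (@coverable_seq _ _ _ _ _ _ [seq cube_of f | f <- enum (family F)]).
- exact: cubevol_ge0.
- move=> x bx.
  have xj j : 0 <= (x ord0 j - a ord0 j) / del <= D j / del.
    have /andP[h1 h2] := bx j; rewrite /= mxE in h2.
    rewrite divr_ge0 ?subr_ge0 ?(ltW del0)//= ler_pM2r ?invr_gt0//.
    by rewrite lerBlDl.
  pose t j := Num.truncn ((x ord0 j - a ord0 j) / del).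
  have tK j : (t j < K j)%N.
    by rewrite ltnS; apply: le_truncn; have /andP[] := xj j.
  have tKm j : (t j < Kmax)%N.
    by apply: leq_trans (tK j) _; exact: (leq_bigmax (F := K)).
  pose f := [ffun j => Ordinal (tKm j)] : {ffun 'I_m -> 'I_Kmax}.
  have fF : f \in family F.
    by apply/familyP => j; rewrite /F ffunE; exact: tK.
  exists (cube_of f); first by rewrite map_f// mem_enum.
  rewrite /cube/=.
  rewrite (gtr0_norm (divr_gt0 _ _))//; apply/row_normP; first by rewrite divr_ge0// ltW.
  move=> j; rewrite !mxE ffunE/=.
  have /andP[h1 _] := xj j; have /andP[] := truncn_itv h1.
  rewrite -/(t j) ler_pdivlMr// ltr_pdivrMr// -natr1 => h2 h3.
  rewrite ler_norml; apply/andP; split; nra.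
- rewrite big_map big_enum /= (eq_bigr (fun=> del ^+ m)); last first.
    move=> f _; rewrite /cubevol/= gtr0_norm ?divr_gt0//.
    by rewrite mulrC divfK.
  have cF j : #|F j| = K j.
    have KK : (K j <= Kmax)%N by exact: (leq_bigmax (F := K)).
    rewrite -sum1_card (eq_bigl (fun i : 'I_Kmax => (i < K j)%N))//.
    by rewrite (big_ord_narrow KK) sum1_card card_ord.
  rewrite sumr_const card_family -mulr_natl foldrE big_image/=.
  apply: le_trans hdel; rewrite natr_prod.
  rewrite -[m in _ ^+ m]card_ord -prodr_const -big_split/=.
  apply: ler_prod => j _; rewrite cF mulr_ge0 ?ler0n ?(ltW del0)//=.
  have /andP[h _] := truncn_itv (Dd j).
  by rewrite -natr1 mulrDl mul1r lerD2r -ler_pdivlMr.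
Qed.

(** A Lipschitz map controls the volume of the image of a cube, but not that of
    the image of an elongated box; null sets are stable under Lipschitz maps
    because they can be covered by cubes. *)
Lemma lebesgue_nullP_cubes X :
  lebesgue_null X <-> forall e, 0 < e -> coverable cube cubevol X e.
Proof.
split=> Xn e e0.
- have e20 : 0 < e / 2 by rewrite divr_gt0.
  have [s [Xs se]] := Xn _ e20.
  pose Y k := oapp box set0 (s k).
  apply: (@coverable_sub _ _ _ _ _ (\bigcup_k Y k) _ e e _ (lexx _)) => //.
  apply: (@coverable_bigcup _ _ _ _ _ _
    (fun k => oapp boxvol 0 (s k) + e / 2 / 2 ^+ k.+1)).
  + exact: cubevol_ge0.
  + move=> k; rewrite addr_ge0 ?divr_ge0 ?exprn_ge0 ?(ltW e0)//.
    by case: (s k) => //= ?; exact: boxvol_ge0.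
  + move=> k; have ek : 0 < e / 2 / 2 ^+ k.+1 by rewrite divr_gt0// exprn_gt0.
    rewrite /Y; case: (s k) => [ad|] /=; first exact: box_coverable_cubes.
    exists (fun=> None); split=> // j.
    by rewrite big1// add0r ltW.
  + move=> k; rewrite big_split/= [leRHS]splitr lerD ?se//.
    exact/sum_half_powers_le/ltW.
- rewrite -[e]mul1r; apply: (@coverable_transfer _ _ _ _ _ cube cubevol
    box boxvol eq 1 X X e ler01 _ _ (Xn e e0)); last by move=> y Xy; exists y.
  move=> [x r]; exists (Some (x - const_mx `|r|, const_mx (2 * `|r|))); split.
    rewrite mul1r /boxvol /cubevol/= (eq_bigr (fun=> 2 * `|r|)).
      by rewrite prodr_const card_ord.
    by move=> j _; rewrite mxE ger0_norm// mulr_ge0.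
  move=> y _ _ _ + <- j; rewrite /cube/= => /row_normP -/(_ (normr_ge0 _) j).
  rewrite !mxE ler_norml (ger0_norm (mulr_ge0 _ _))// => /andP[h1 h2].
  apply/andP; split; lra.
Qed.

End NullSets.

(** * Maps that are Lipschitz up to a countable partition *)

Section SigmaLipschitz.
Context {R : realType}.

(** [f1] is, on each of countably many classes, a Lipschitz function of [f0].  In
    particular [f0] determines [f1] inside a class, though not on the whole
    of [D].  Both maps are functions on an abstract set because the geodesics
    will be compared through their states at two different times. *)
Definition sigma_lipschitz {G : Type} {V0 V1 : normedModType R} (D : set G)
    (f0 : G -> V0) (f1 : G -> V1) : Prop :=
  exists cls : G -> nat, forall d, exists2 C, 0 <= C &
    forall x y, D x -> D y -> cls x = d -> cls y = d ->
      `|f1 x - f1 y| <= C * `|f0 x - f0 y|.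

Definition pointwise_lipschitz {V W : normedModType R} (f : V -> W) (x : V) :=
  exists k : R, \forall y \near x, `|f y - f x| <= k * `|y - x|.

(** A form of separability: countable partitions of arbitrarily small mesh. *)
Definition countably_meshed (V : normedModType R) : Prop :=
  forall e : R, 0 < e ->
    exists cell : V -> nat, forall x y, cell x = cell y -> `|x - y| <= e.

Section Basic.
Context {G : Type}.
Implicit Types D : set G.

Lemma lipschitz_sigma {V0 V1 : normedModType R} D (f0 : G -> V0) (f1 : G -> V1) (C : R) :
  0 <= C ->
  (forall x y, D x -> D y -> `|f1 x - f1 y| <= C * `|f0 x - f0 y|) ->
  sigma_lipschitz D f0 f1.
Proof. by move=> C0 h; exists (fun=> 0%N) => d; exists C => // x y *; exact: h. Qed.

Lemma sigma_lipschitz_sub {V0 V1 : normedModType R} D D' (f0 : G -> V0) (f1 : G -> V1) :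
  D' `<=` D -> sigma_lipschitz D f0 f1 -> sigma_lipschitz D' f0 f1.
Proof.
move=> DD [cls h]; exists cls => d; have [C C0 hC] := h d.
by exists C => // x y /DD Dx /DD Dy; exact: hC.
Qed.

Lemma sigma_lipschitz_eq {V0 V1 : normedModType R} D (f0 f0' : G -> V0) (f1 f1' : G -> V1) :
  (forall x, D x -> f0 x = f0' x) -> (forall x, D x -> f1 x = f1' x) ->
  sigma_lipschitz D f0 f1 -> sigma_lipschitz D f0' f1'.
Proof.
move=> e0 e1 [cls h]; exists cls => d; have [C C0 hC] := h d.
by exists C => // x y Dx Dy; rewrite -!e0// -!e1//; exact: hC.
Qed.

(** The class for the composite is the pair of the two classes. *)
Lemma sigma_lipschitz_trans {V0 V1 V2 : normedModType R} D (f0 : G -> V0)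
    (f1 : G -> V1) (f2 : G -> V2) :
  sigma_lipschitz D f0 f1 -> sigma_lipschitz D f1 f2 -> sigma_lipschitz D f0 f2.
Proof.
move=> [c1 h1] [c2 h2]; exists (fun x => pickle (c1 x, c2 x)) => d.
(* A class that meets [D] is decoded by looking at one of its elements. *)
have [[x0 [Dx0 dx0]]|no] := pselect (exists x, D x /\ pickle (c1 x, c2 x) = d); last first.
  by exists 0 => // x y Dx _ dx; case: no; exists x.
have [C1 C10 hC1] := h1 (c1 x0); have [C2 C20 hC2] := h2 (c2 x0).
exists (C2 * C1); first exact: mulr_ge0.
move=> x y Dx Dy; rewrite -dx0 => /(pcan_inj pickleK)[x1 x2] /(pcan_inj pickleK)[y1 y2].
by rewrite -mulrA (le_trans (hC2 _ _ _ _ x2 y2))// ler_wpM2l// hC1.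
Qed.

(** Choose for each point a member of the cover that contains it, and record the
    choice together with the class inside this member. *)
Lemma sigma_lipschitz_cover (T : countType) {V0 V1 : normedModType R} D
    (E : T -> set G) (f0 : G -> V0) (f1 : G -> V1) :
  D `<=` \bigcup_t E t -> (forall t, sigma_lipschitz (E t) f0 f1) ->
  sigma_lipschitz D f0 f1.
Proof.
move=> DE /choice[c hc].
have /choice[op hop] : forall x, exists o : option T, D x -> exists2 t, o = Some t & E t x.
  move=> x; have [/DE[t _ Et]|nD] := pselect (D x); last by exists None.
  by exists (Some t) => _; exists t.
exists (fun x => pickle (omap (fun t => (t, c t x)) (op x))) => d.
have [[x0 [Dx0 dx0]]|no] := pselect (exists x, D x /\ pickle (omap (fun t => (t, c t x)) (op x)) = d); last first.
  by exists 0 => // x y Dx _ dx; case: no; exists x.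
have [t ot Et] := hop x0 Dx0; have [C C0 hC] := hc t (c t x0).
exists C => // x y Dx Dy; rewrite -dx0 ot/= => /(pcan_inj pickleK) ex /(pcan_inj pickleK) ey.
have [s1 os1 Es1] := hop x Dx; have [s2 os2 Es2] := hop y Dy.
move: ex ey; rewrite os1 os2 /= => -[ts1 c1] [ts2 c2].
by move: Es1 Es2 c1 c2; rewrite ts1 ts2 => *; exact: hC.
Qed.

Lemma sigma_lipschitz_family {V0 V1 : normedModType R} N D (f0 : G -> V0)
    (f1 : 'I_N -> G -> V1) {W : normedModType R} (g : G -> W) :
  (forall i, sigma_lipschitz D f0 (f1 i)) ->
  (forall x y s, D x -> D y -> 0 <= s -> (forall i, `|f1 i x - f1 i y| <= s) ->
     `|g x - g y| <= s) ->
  sigma_lipschitz D f0 g.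
Proof.
move=> /choice[c hc] hg; exists (fun x => pickle [ffun i => c i x]) => d.
have [[x0 [Dx0 dx0]]|no] := pselect (exists x, D x /\ pickle [ffun i => c i x] = d); last first.
  by exists 0 => // x y Dx _ dx; case: no; exists x.
have /choice[C hC] : forall i, exists C, 0 <= C /\ forall x y, D x -> D y ->
    c i x = c i x0 -> c i y = c i x0 -> `|f1 i x - f1 i y| <= C * `|f0 x - f0 y|.
  by move=> i; have [C C0 hC] := hc i (c i x0); exists C.
have C0 i : 0 <= C i by have [] := hC i.
exists (\sum_i C i); first by apply: sumr_ge0.
move=> x y Dx Dy; rewrite -dx0 => /(pcan_inj pickleK) ex /(pcan_inj pickleK) ey.
apply: hg => // [|i]; first by rewrite mulr_ge0// sumr_ge0.
have [_ h] := hC i; apply: le_trans (h x y _ _ _ _) _ => //.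
- by move/ffunP : ex => /(_ i); rewrite !ffunE.
- by move/ffunP : ey => /(_ i); rewrite !ffunE.
- by rewrite ler_wpM2r// (bigD1 i)//= lerDl sumr_ge0.
Qed.

(** A Lipschitz bound at each single point, with constant and radius depending on
    the point, becomes uniform on countably many pieces: for a natural [k]
    consider the points with constant [k] and radius [1/(k+1)], and cut this set
    into pieces of diameter less than [1/(k+1)]. *)
Lemma sigma_lipschitz_pointwise {V0 V1 : normedModType R} D (f0 : G -> V0)
    (f1 : G -> V1) (F : V0 -> V1) :
  countably_meshed V0 ->
  (forall x, D x -> f1 x = F (f0 x)) ->
  (forall x, D x -> pointwise_lipschitz F (f0 x)) ->
  sigma_lipschitz D f0 f1.
Proof.
move=> mV fF hF.
have /choice[cell hcell] : forall k : nat, exists cell : V0 -> nat,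
    forall x y, cell x = cell y -> `|x - y| <= k.+2%:R^-1.
  by move=> k; apply: mV; rewrite invr_gt0.
pose E (t : nat * nat) := [set x | [/\ D x, cell t.1 (f0 x) = t.2 &
  forall y, `|y - f0 x| < t.1.+1%:R^-1 -> `|F y - F (f0 x)| <= t.1%:R * `|y - f0 x|]].
apply: (@sigma_lipschitz_cover _ _ _ D E).
  move=> x Dx; have [k /nbhs_ballP[e /= e0 he]] := hF x Dx.
  pose n := maxn (Num.truncn k).+1 (Num.truncn e^-1).+1.
  exists (n, cell n (f0 x)) => //; split=> //= y yx.
  apply: (@le_trans _ _ (k * `|y - f0 x|)).
    apply: he; rewrite -ball_normE/= distrC (lt_trans yx)//.
    rewrite -[ltRHS]invrK ltf_pV2 ?posrE ?invr_gt0//.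
    apply: lt_le_trans (truncnS_gt _) _; rewrite ler_nat.
    by rewrite (leq_trans (leq_maxr (Num.truncn k).+1 _))// leqW.
  rewrite ler_wpM2r//; apply: ltW; apply: lt_le_trans (truncnS_gt _) _.
  by rewrite ler_nat leq_maxl.
move=> -[k c]; apply: (@lipschitz_sigma _ _ _ _ _ k%:R) => // x y [Dx cx hx] [Dy cy hy].
rewrite !fF// distrC [X in _ <= _ * X]distrC; apply: hx => /=.
rewrite (le_lt_trans (hcell k _ _ _)) ?cx ?cy//.
by rewrite ltf_pV2 ?posrE// ltr_nat.
Qed.

Lemma sigma_lipschitz_pullback {G' : Type} {V0 V1 : normedModType R} (h : G' -> G)
   (D' : set G') D (f0 : G -> V0) (f1 : G -> V1) :
  (forall x, D' x -> D (h x)) -> sigma_lipschitz D f0 f1 ->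
  sigma_lipschitz D' (f0 \o h) (f1 \o h).
Proof.
move=> hD [c hc]; exists (c \o h) => d; have [C C0 hC] := hc d.
by exists C => // x y /hD Dx /hD Dy; exact: hC.
Qed.

(** Within a class, the values of [f1] over a cube that contains some [f0 x0] lie
    in the cube centred at [f1 x0] with radius [2 C r]; the factor [2 C + 1] is
    used to have a positive ratio. *)
Lemma lebesgue_null_image_sigma_lipschitz {m : nat} D (f0 f1 : G -> 'rV[R]_m) :
  sigma_lipschitz D f0 f1 -> lebesgue_null (f0 @` D) -> lebesgue_null (f1 @` D).
Proof.
move=> [c hc] n0.
apply: (@lebesgue_null_countable_cover _ _ _ (fun d => f1 @` (D `&` [set x | c x = d]))).
  by move=> _ [x Dx <-]; exists (c x) => //; exists x.
move=> d; have [C C0 hC] := hc d; apply/lebesgue_nullP_cubes => e e0.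
have C2 : 0 < (2 * C + 1) ^+ m by rewrite exprn_gt0// ltr_wpDl// mulr_ge0.
have -> : e = (2 * C + 1) ^+ m * (e / (2 * C + 1) ^+ m).
  by rewrite mulrC divfK// gt_eqF.
have {n0}/lebesgue_nullP_cubes n0 := n0; have {}n0 := n0 _ (divr_gt0 e0 C2).
apply: (coverable_transfer (rho := fun u v => exists x, [/\ D x, c x = d, f0 x = u & f1 x = v]) _ _ _ n0).
- exact: ltW.
- move=> [z r].
  have [[x0 [Dx0 cx0 zx0]]|no] := pselect (exists x, [/\ D x, c x = d & cube (z, r) (f0 x)]).
    exists (Some (f1 x0, (2 * C + 1) * `|r|)); split.
      rewrite /= /cubevol/= normrM normr_id ger0_norm ?addr_ge0 ?mulr_ge0//.
      by rewrite -exprMn mulrCA.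
    move=> u v _ _ zu [x [Dx cx xu xv]]; rewrite /= /cube/=.
    rewrite normrM normr_id ger0_norm ?addr_ge0 ?mulr_ge0// -xv.
    apply: (le_trans (hC _ _ Dx Dx0 cx cx0)).
    have : `|f0 x - f0 x0| <= 2 * `|r|.
      move: zx0 zu; rewrite /cube/= xu => h1 h2.
      by rewrite -(subrKA z) (le_trans (ler_normD _ _))// [`|z - _|]distrC mulr2n mulrDl mul1r lerD.
    move=> h; rewrite (le_trans (ler_wpM2l C0 h))//.
    have := normr_ge0 r; nra.
  exists None; split; first by rewrite mulr_ge0 ?(ltW C2)//; exact: cubevol_ge0.
  move=> u v _ _ zu [x [Dx cx xu xv]]; apply: no; exists x; split=> //.
  by rewrite xu.
- move=> _ [x [Dx cx] <-]; exists (f0 x); first by exists x.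
  by exists x.
Qed.

End Basic.

(** Cells of the grid [e Z^m]. *)
Lemma countably_meshed_row m : countably_meshed 'rV[R]_m.
Proof.
move=> e e0; exists (fun x : 'rV[R]_m => pickle (\row_j Num.floor (x ord0 j / e))).
move=> x y /(pcan_inj pickleK) /rowP xy; apply/row_normP; first exact: ltW.
move=> j; have := xy j; rewrite !mxE => fj.
have /andP[x1 x2] := floor_itv (x ord0 j / e).
have /andP[y1 y2] := floor_itv (y ord0 j / e).
move: x1 x2; rewrite fj => x1 x2.
move: x1 x2 y1 y2; rewrite intrD !ler_pdivlMr// !ltr_pdivrMr// => x1 x2 y1 y2.
rewrite ler_norml; apply/andP; split; nra.
Qed.

Lemma countably_meshed_prod (V W : normedModType R) :
  countably_meshed V -> countably_meshed W -> countably_meshed (V * W)%type.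
Proof.
move=> hV hW e e0; have [c1 h1] := hV e e0; have [c2 h2] := hW e e0.
exists (fun x => pickle (c1 x.1, c2 x.2)) => x y /(pcan_inj pickleK)[xy1 xy2].
by rewrite {1}/Num.norm/= ge_max h1//= h2.
Qed.

(** The differential is a bounded linear map and the remainder is at most [|y - x|]
    near [x]. *)
Lemma differentiable_pointwise_lipschitz (V W : normedModType R) (f : V -> W) x :
  differentiable f x -> pointwise_lipschitz f x.
Proof.
move=> df; have [k k0 hk] := linear_lipschitz (diff_continuous df).
have := diff_locally df; set o := 'o _ => fo.
have /(littleoP [littleo of o])/nbhs_ballP[e /= e0 he] := @ltr01 R.
exists (k + 1); apply/nbhs_ballP; exists e => //= y yx.
have -> : f y = f x + 'd f x (y - x) + o (y - x).
  by have /(congr1 (fun g => g (y - x))) := fo; rewrite /= subrK.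
rewrite -[X in X - _]addrA [X in X - _]addrC addrK mulrDl (le_trans (ler_normD _ _))// lerD//.
apply: he; rewrite -ball_normE/= sub0r normrN.
by rewrite -ball_normE/= distrC in yx.
Qed.

Lemma lebesgue_null_image_differentiable m (X : set 'rV[R]_m)
    (f : 'rV[R]_m -> 'rV[R]_m) :
  (forall x, X x -> differentiable f x) -> lebesgue_null X ->
  lebesgue_null (f @` X).
Proof.
move=> df Xn; apply: (@lebesgue_null_image_sigma_lipschitz _ _ _ id).
  apply: (sigma_lipschitz_pointwise (F := f)) => //.
    exact: countably_meshed_row.
  by move=> x Xx; exact/differentiable_pointwise_lipschitz/df.
by rewrite image_id.
Qed.

End SigmaLipschitz.

(** * Locally Lipschitz functions *)

Section LocallyLipschitz.
Context {R : realType}.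

(** Lipschitz bounds between any two points near [x].  Unlike
    [pointwise_lipschitz], this allows two solutions of a differential equation
    to be compared. *)
Definition locally_lipschitz {V W : normedModType R} (f : V -> W) (x : V) : Prop :=
  exists k : R, \forall p \near (x, x), `|f p.1 - f p.2| <= k * `|p.1 - p.2|.

Lemma near_fst {V : normedModType R} (P : V -> Prop) (x : V) :
  (\forall y \near x, P y) -> \forall p \near (x, x), P p.1.
Proof. by move=> h; exists (P, setT) => [|[y z] []]//; split=> //; exact: filterT. Qed.

Lemma near_snd {V : normedModType R} (P : V -> Prop) (x : V) :
  (\forall y \near x, P y) -> \forall p \near (x, x), P p.2.
Proof. by move=> h; exists (setT, P) => [|[y z] []]//; split=> //; exact: filterT. Qed.

Lemma locally_lipschitz_continuous {V W : normedModType R} (f : V -> W) (x : V) :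
  locally_lipschitz f x -> {for x, continuous f}.
Proof.
move=> [k hk]; apply/cvgrPdist_le => e e0.
have k0 : 0 < `|k| + 1 by rewrite ltr_wpDl.
have h2 : \forall y \near x, `|f x - f y| <= k * `|x - y|.
  move: hk => [[A B] /= [Ax Bx] AB]; near=> y.
  apply: (AB (x, y)); split => /=; first exact: nbhs_singleton.
  by near: y.
near=> y; apply: (@le_trans _ _ (k * `|x - y|)); first by near: y.
apply: (@le_trans _ _ ((`|k| + 1) * `|x - y|)).
  by rewrite ler_wpM2r// (le_trans (ler_norm k))// lerDl.
rewrite -ler_pdivlMl// mulrC; near: y.
by apply: cvgr_dist_le => //; rewrite divr_gt0.
Unshelve. all: by end_near. Qed.

Lemma locally_lipschitz_ball {V W : normedModType R} (f : V -> W) (x : V) :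
  locally_lipschitz f x -> exists k e : R, [/\ 0 <= k, 0 < e &
    forall y z, `|y - x| < e -> `|z - x| < e -> `|f y - f z| <= k * `|y - z|].
Proof.
move=> [k [[A B] /= [/nbhs_ballP[e1 /= e10 Ae] /nbhs_ballP[e2 /= e20 Be]] AB]].
exists `|k|, (Num.min e1 e2); split=> //; first by rewrite lt_min e10.
move=> y z; rewrite !lt_min => /andP[y1 _] /andP[_ z2].
apply: (@le_trans _ _ (k * `|y - z|)); last by rewrite ler_wpM2r// ler_norm.
apply: (AB (y, z)); split => /=; [apply: Ae|apply: Be].
- by rewrite -ball_normE/= distrC.
- by rewrite -ball_normE/= distrC.
Qed.

Lemma locally_lipschitz_pointwise {V W : normedModType R} (f : V -> W) x :
  locally_lipschitz f x -> pointwise_lipschitz f x.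
Proof.
move=> [k [[A B] /= [Ax Bx] AB]]; exists k; near=> y.
by apply: (AB (y, x)); split => /=; [near: y | exact: nbhs_singleton].
Unshelve. all: by end_near. Qed.

Lemma locally_lipschitz_near_eq {V W : normedModType R} (f g : V -> W) (x : V) :
  (\forall y \near x, f y = g y) -> locally_lipschitz f x -> locally_lipschitz g x.
Proof.
move=> fg [k hk]; exists k; have fg1 := near_fst fg; have fg2 := near_snd fg.
near=> p.
have <- : f p.1 = g p.1 by near: p.
have <- : f p.2 = g p.2 by near: p.
by near: p.
Unshelve. all: by end_near. Qed.

Section Scalar.
Context {V : normedModType R}.
Implicit Types (f g : V -> R) (x : V).

Lemma locally_lipschitz_cst (c : R) x : locally_lipschitz (fun=> c) x.
Proof. by exists 0; near=> p; rewrite subrr normr0 mul0r. Unshelve. all: by end_near. Qed.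

Lemma locally_lipschitzD f g x : locally_lipschitz f x -> locally_lipschitz g x ->
  locally_lipschitz (fun y => f y + g y) x.
Proof.
move=> [k1 h1] [k2 h2]; exists (k1 + k2); near=> p.
rewrite opprD addrACA mulrDl (le_trans (ler_normD _ _))// lerD//; by near: p.
Unshelve. all: by end_near. Qed.

Lemma locally_lipschitzN f x : locally_lipschitz f x ->
  locally_lipschitz (fun y => - f y) x.
Proof.
move=> [k1 h1]; exists k1; near=> p.
by rewrite -opprD normrN; near: p.
Unshelve. all: by end_near. Qed.

Lemma locally_lipschitzM f g x : locally_lipschitz f x -> locally_lipschitz g x ->
  locally_lipschitz (fun y => f y * g y) x.
Proof.
move=> lf lg; have cf := locally_lipschitz_continuous lf.
have cg := locally_lipschitz_continuous lg.
move: lf lg => [k1 h1] [k2 h2].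
have bnd (h : V -> R) : h y @[y --> x] --> h x -> \forall y \near x, `|h y| <= `|h x| + 1.
  move=> /cvgrPdist_le /(_ 1 ltr01); apply: filterS => y hy.
  by rewrite -(subrK (h x) (h y)) addrC (le_trans (ler_normD _ _))// lerD2l distrC.
have bf := near_fst (bnd f cf); have bg := near_snd (bnd g cg).
exists ((`|f x| + 1) * k2 + k1 * (`|g x| + 1)); near=> p.
have -> : f p.1 * g p.1 - f p.2 * g p.2 =
  f p.1 * (g p.1 - g p.2) + (f p.1 - f p.2) * g p.2 by ring.
rewrite [leRHS]mulrDl (le_trans (ler_normD _ _))// !normrM; apply: lerD.
  by rewrite -mulrA; apply: ler_pM => //; near: p.
by rewrite mulrAC; apply: ler_pM => //; near: p.
Unshelve. all: by end_near. Qed.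

(** Near [x] one has [|f| >= |f x| / 2 =: a], and the difference of the inverses is
    the difference of the values divided by a product of size at least [a^2]. *)
Lemma locally_lipschitzV f x : f x != 0 -> locally_lipschitz f x ->
  locally_lipschitz (fun y => (f y)^-1) x.
Proof.
move=> f0 lf; have cf := locally_lipschitz_continuous lf; case: lf => k hk.
pose a := `|f x| / 2; have a0 : 0 < a by rewrite divr_gt0// normr_gt0.
have fa : \forall y \near x, a <= `|f y|.
  move/cvgrPdist_le : cf => /(_ a a0); apply: filterS => y h.
  have := lerB_dist (f x) (f y); rewrite /a in h *; lra.
have fa1 := near_fst fa; have fa2 := near_snd fa.
exists ((a * a)^-1 * k); near=> p.
have h1 : a <= `|f p.1| by near: p.
have h2 : a <= `|f p.2| by near: p.
have n1 : f p.1 != 0 by rewrite -normr_gt0 (lt_le_trans a0).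
have n2 : f p.2 != 0 by rewrite -normr_gt0 (lt_le_trans a0).
have -> : (f p.1)^-1 - (f p.2)^-1 = (f p.1 * f p.2)^-1 * (f p.2 - f p.1).
  by field; rewrite n1 n2.
rewrite normrM -mulrA; apply: ler_pM => //; last by rewrite distrC; near: p.
rewrite normfV lef_pV2 ?posrE ?mulr_gt0 ?normr_gt0 ?mulf_neq0//.
by rewrite normrM ler_pM// ltW.
Unshelve. all: by end_near. Qed.

Lemma locally_lipschitz_sum (I : Type) (r : seq I) (P : pred I) (f : I -> V -> R) x :
  (forall i, locally_lipschitz (f i) x) ->
  locally_lipschitz (fun y => \sum_(i <- r | P i) f i y) x.
Proof.
move=> h; elim: r => [|i r IH].
  apply: locally_lipschitz_near_eq (locally_lipschitz_cst 0 x).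
  by near=> y; rewrite big_nil.
apply: (@locally_lipschitz_near_eq _ _ (fun y => (if P i then f i y else 0) + \sum_(i <- r | P i) f i y)).
  by near=> y; rewrite big_cons; case: ifP => // _; rewrite add0r.
apply: locally_lipschitzD => //; case: (P i) => //; exact: locally_lipschitz_cst.
Unshelve. all: by end_near. Qed.

Lemma locally_lipschitz_prod (I : Type) (r : seq I) (P : pred I) (f : I -> V -> R) x :
  (forall i, locally_lipschitz (f i) x) ->
  locally_lipschitz (fun y => \prod_(i <- r | P i) f i y) x.
Proof.
move=> h; elim: r => [|i r IH].
  apply: locally_lipschitz_near_eq (locally_lipschitz_cst 1 x).
  by near=> y; rewrite big_nil.
apply: (@locally_lipschitz_near_eq _ _ (fun y => (if P i then f i y else 1) * \prod_(i <- r | P i) f i y)).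
  by near=> y; rewrite big_cons; case: ifP => // _; rewrite mul1r.
apply: locally_lipschitzM => //; case: (P i) => //; exact: locally_lipschitz_cst.
Unshelve. all: by end_near. Qed.

Lemma locally_lipschitz_det n (A : V -> 'M[R]_n) x :
  (forall i j, locally_lipschitz (fun y => A y i j) x) ->
  locally_lipschitz (fun y => \det (A y)) x.
Proof.
move=> h; apply: locally_lipschitz_sum => s; apply: locally_lipschitzM.
  exact: locally_lipschitz_cst.
by apply: locally_lipschitz_prod => i.
Qed.

(** Cramer's formula expresses the inverse through determinants. *)
Lemma locally_lipschitz_invmx n (A : V -> 'M[R]_n) x (k l : 'I_n) :
  (\forall y \near x, A y \in unitmx) ->
  (forall i j, locally_lipschitz (fun y => A y i j) x) ->
  locally_lipschitz (fun y => invmx (A y) k l) x.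
Proof.
move=> uA h.
apply: (@locally_lipschitz_near_eq _ _ (fun y => (\det (A y))^-1 * \adj (A y) k l)).
  by near=> y; rewrite /invmx ifT ?mxE//; near: y.
apply: locally_lipschitzM.
  apply: locally_lipschitzV; last exact: locally_lipschitz_det.
  by rewrite -unitfE -unitmxE; exact: nbhs_singleton uA.
apply: (@locally_lipschitz_near_eq _ _ (fun y => cofactor (A y) l k)).
  by near=> y; rewrite mxE.
apply: locally_lipschitzM; first exact: locally_lipschitz_cst.
apply: locally_lipschitz_det => i j.
apply: (@locally_lipschitz_near_eq _ _ (fun y => A y (lift l i) (lift k j))) => //.
by near=> y; rewrite !mxE.
Unshelve. all: by end_near. Qed.

End Scalar.

Lemma locally_lipschitz_comp {U V W : normedModType R} (f : U -> V) (g : V -> W) x :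
  locally_lipschitz f x -> locally_lipschitz g (f x) ->
  locally_lipschitz (g \o f) x.
Proof.
move=> lf [k2 h2]; have cf := locally_lipschitz_continuous lf.
case: lf => k1 h1; case: h2 => [[A B] /= [Ax Bx] AB].
have hA := near_fst (cf A Ax : \forall y \near x, A (f y)).
have hB := near_snd (cf B Bx : \forall y \near x, B (f y)).
exists (`|k2| * k1); near=> p.
apply: (@le_trans _ _ (k2 * `|f p.1 - f p.2|)).
  by apply: (AB (f p.1, f p.2)); split => /=; near: p.
apply: (@le_trans _ _ (`|k2| * `|f p.1 - f p.2|)); first by rewrite ler_wpM2r// ler_norm.
by rewrite -mulrA ler_wpM2l//; near: p.
Unshelve. all: by end_near. Qed.

Lemma locally_lipschitz_pair {U V W : normedModType R}
    (f : U -> V) (h : U -> W) x :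
  locally_lipschitz f x -> locally_lipschitz h x ->
  locally_lipschitz (fun y => (f y, h y)) x.
Proof.
move=> [k1 h1] [k2 h2]; exists (Num.max k1 k2); near=> p.
rewrite [leLHS]prod_normE ge_max /=; apply/andP; split.
  apply: (@le_trans _ _ (k1 * `|p.1 - p.2|)); first by near: p.
  by rewrite ler_wpM2r// le_max lexx.
apply: (@le_trans _ _ (k2 * `|p.1 - p.2|)); first by near: p.
by rewrite ler_wpM2r// le_max lexx orbT.
Unshelve. all: by end_near. Qed.

Lemma row_diffE n {W : normedModType R} (f : 'rV[R]_n -> W) (y v : 'rV[R]_n) :
  differentiable f y ->
  'd f y v = \sum_(i < n) v ord0 i *: 'D_(delta_mx ord0 i) f y.
Proof.
move=> df; rewrite {1}(row_sum_delta v) linear_sum/=; apply: eq_bigr => i _.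
by rewrite linearZ/= deriveE.
Qed.

(** Mean value theorem along the segment [z, y], which stays in a ball where the
    partial derivatives are bounded; [B] bounds the sum of their absolute
    values, which is the norm of the differential for the sup norm. *)
Lemma continuous_partials_locally_lipschitz n (f : 'rV[R]_n -> R) (h : 'I_n -> 'rV[R]_n -> R) x :
  (\forall y \near x, differentiable f y) ->
  (forall i, \forall y \near x, 'D_(delta_mx ord0 i) f y = h i y) ->
  (forall i, {for x, continuous (h i)}) ->
  locally_lipschitz f x.
Proof.
move=> df dh ch; pose B := \sum_(i < n) (`|h i x| + 1).
have : \forall y \near x, differentiable f y /\ forall i, `|'D_(delta_mx ord0 i) f y| <= `|h i x| + 1.
  near=> y; split; first by near: y.
  near: y; apply: filter_forall => i; near=> y.
  rewrite (near (dh i) y)//; near: y.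
  move/cvgrPdist_le : (ch i) => /(_ 1 ltr01); apply: filterS => y hy.
  by rewrite -(subrK (h i x) (h i y)) addrC (le_trans (ler_normD _ _))// lerD2l distrC.
move=> /nbhs_ballP[e /= e0 he]; exists B.
exists (ball x e, ball x e) => /=; first by split; exact: nbhsx_ballx.
move=> [y z] [/= xy xz].
pose v := y - z; pose g : R -> 'rV[R]_n := cst z + ( *:%R ^~ v).
have gE t : g t = z + t *: v by [].
have gb (t : R) : 0 <= t <= 1 -> ball x e (g t).
  move=> /andP[t0 t1]; move: xy xz; rewrite -!ball_normE/= => xy xz.
  have -> : x - g t = (1 - t) *: (x - z) + t *: (x - y).
    by rewrite gE /v; apply/rowP => j; rewrite !mxE; ring.
  pose M := Num.max `|x - z| `|x - y|.
  have Me : M < e by rewrite gt_max xy xz.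
  apply: le_lt_trans Me; rewrite (le_trans (ler_normD _ _))// !normrZ.
  rewrite !ger0_norm ?subr_ge0// -[M]mul1r -[X in X * M](subrK t) [leRHS]mulrDl.
  by rewrite lerD// ler_wpM2l ?subr_ge0// le_max lexx ?orbT.
have dg (t : R) : is_diff t g ( *:%R ^~ v).
  rewrite -[X in is_diff _ _ X](add0r ( *:%R ^~ v)).
  exact: (is_diffD (is_diff_cst z t) (is_diff_scalel t v)).
have dphi (t : R) : 0 <= t <= 1 -> is_derive t 1 (f \o g) ('d f (g t) v).
  move=> /gb/he[dfg _]; have dgt : differentiable g t by [].
  have dc := differentiable_comp dgt dfg.
  apply: DeriveDef; first exact: diff_derivable.
  by rewrite deriveE// diff_comp//= diff_val scale1r.
have cphi : {within `[0%R, 1%R], continuous (f \o g)}.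
  apply: derivable_within_continuous => t; rewrite in_itv/= => t01.
  by have [] := dphi t t01.
have dphi' (t : R) : t \in `]0%R, 1%R[ -> is_derive t 1 (f \o g) ('d f (g t) v).
  by rewrite in_itv/= => /andP[t0 t1]; apply: dphi; rewrite !ltW.
have [t + ] := MVT_segment (@ler01 R) dphi' cphi.
rewrite in_itv/= => t01; rewrite /= !gE scale1r scale0r addr0 /v subrKC subr0 mulr1 => ->.
have [dfg hb] := he _ (gb t t01).
rewrite row_diffE// mulr_suml (le_trans (ler_norm_sum _ _ _))//.
apply: ler_sum => i _; rewrite normrZ mulrC ler_pM//.
by have /row_normP-/(_ (normr_ge0 _)) := lexx `|y - z|; exact.
Unshelve. all: by end_near. Qed.

(** All iterated derivatives of a smooth map are differentiable, so the partial
    derivatives of any of them are continuous. *)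
Lemma smooth_on_entry_locally_lipschitz n p q (U : set 'rV[R]_n)
    (F : 'rV[R]_n -> 'M[R]_(p, q)) s x j k :
  open U -> smooth_on U F -> U x ->
  locally_lipschitz (fun y => iter_derive s F y j k) x.
Proof.
move=> oU sF Ux; have nU := open_near oU Ux.
have dE s' y : U y -> differentiable (fun z => iter_derive s' F z j k) y.
  move=> Uy; apply: (differentiable_comp (f := iter_derive s' F) (g := fun M : 'M[R]_(p, q) => M j k)).
    exact: sF.
  exact: differentiable_coord.
apply: (continuous_partials_locally_lipschitz
  (h := fun i y => iter_derive (delta_mx ord0 i :: s) F y j k)).
- by apply: filterS nU => y Uy; exact: dE.
- move=> i; apply: filterS nU => y Uy /=.
  by rewrite derive_mx ?mxE//; apply: diff_derivable; exact: sF.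
- by move=> i; apply: differentiable_continuous; exact: dE.
Qed.

Lemma locally_lipschitz_row n {V : normedModType R} (f : V -> 'rV[R]_n) x :
  (forall i, locally_lipschitz (fun y => f y ord0 i) x) -> locally_lipschitz f x.
Proof.
move=> /choice[k hk]; exists (\sum_i `|k i|); near=> p.
apply/row_normP; first by rewrite mulr_ge0// sumr_ge0.
move=> i; rewrite !mxE.
apply: (@le_trans _ _ (k i * `|p.1 - p.2|)).
  move: i; near: p; exact: filter_forall.
by rewrite ler_wpM2r// (le_trans (ler_norm _))// (bigD1 i)//= lerDl sumr_ge0.
Unshelve. all: by end_near. Qed.

Lemma locally_lipschitz_coord n (x : 'rV[R]_n) i :
  locally_lipschitz (fun y : 'rV[R]_n => y ord0 i) x.
Proof.
exists 1; near=> p; rewrite mul1r.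
have /row_normP-/(_ (normr_ge0 _) i) := lexx `|p.1 - p.2|.
by rewrite !mxE.
Unshelve. all: by end_near. Qed.

Lemma locally_lipschitz_fst {V W : normedModType R} (x : V * W) : locally_lipschitz fst x.
Proof.
by exists 1; near=> p; rewrite mul1r [leRHS]prod_normE le_max lexx.
Unshelve. all: by end_near. Qed.

Lemma locally_lipschitz_snd {V W : normedModType R} (x : V * W) : locally_lipschitz snd x.
Proof.
by exists 1; near=> p; rewrite mul1r [leRHS]prod_normE le_max lexx orbT.
Unshelve. all: by end_near. Qed.

End LocallyLipschitz.

(** * Regularity of the geodesic equation *)

Section Metric.
Context {R : realType} {M : topologicalType} {n : nat}.
Variables (Atl : set (chart R M n)) (g : chart R M n -> M -> 'M[R]_n).
Hypotheses (hA : smooth_atlas Atl) (hg : riemannian_metric Atl g).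
Implicit Types (c d : chart R M n).

(** The geodesic equation in a chart is [x'' = acceleration (x, x')]. *)
Definition acceleration c (z : 'rV[R]_n * 'rV[R]_n) : 'rV[R]_n :=
  \row_k (- \sum_(i < n) \sum_(j < n)
    christoffel g c k i j z.1 * z.2 ord0 i * z.2 ord0 j).

Lemma open_chart_range c : Atl c -> open (chart_range c).
Proof. by have [h _ _] := hA => /h[]. Qed.

Lemma dmetric_locally_lipschitz c i j k x : Atl c -> chart_range c x ->
  locally_lipschitz (dmetric g c i j k) x.
Proof.
move=> Ac cx; have [_ _ sg _] := hg; have oc := open_chart_range Ac.
apply: locally_lipschitz_near_eq
  (smooth_on_entry_locally_lipschitz [:: delta_mx ord0 i] j k oc (sg c Ac) cx).
apply: filterS (open_near oc cx) => y cy /=.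
rewrite /dmetric derive_mx ?mxE//; apply: diff_derivable.
exact: (sg c Ac [::]).
Qed.

(** A vector in the kernel of the Gram matrix would have norm zero. *)
Lemma metric_unitmx c p : Atl c -> chart_dom c p -> g c p \in unitmx.
Proof.
move=> Ac cp; have [_ pos _ _] := hg.
rewrite -row_free_unit -kermx_eq0; apply/eqP; apply/row_matrixP => i.
apply/eqP; rewrite row0; apply/negPn/negP => v0.
have := pos c p _ Ac cp v0.
by rewrite -row_mul mulmx_ker row0 mul0mx mxE ltxx.
Qed.

Lemma christoffel_locally_lipschitz c k i j x : Atl c -> chart_range c x ->
  locally_lipschitz (christoffel g c k i j) x.
Proof.
move=> Ac cx; have [_ _ sg _] := hg; have oc := open_chart_range Ac.
have dl := dmetric_locally_lipschitz _ _ _ Ac cx.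
apply: locally_lipschitzM; first exact: locally_lipschitz_cst.
apply: locally_lipschitz_sum => l; apply: locally_lipschitzM.
  apply: locally_lipschitz_invmx.
    apply: filterS (open_near oc cx) => _ [p cp <-].
    apply: metric_unitmx => //; have [h _ _] := hA; have [_ _ hK _ _] := h c Ac.
    by rewrite hK.
  move=> a b; exact: (smooth_on_entry_locally_lipschitz [::] a b oc (sg c Ac) cx).
by do 2?[apply: locally_lipschitzD => //]; exact: locally_lipschitzN.
Qed.

Lemma acceleration_locally_lipschitz c z : Atl c -> chart_range c z.1 ->
  locally_lipschitz (acceleration c) z.
Proof.
move=> Ac cz; apply: locally_lipschitz_row => k.
rewrite (_ : (fun y => acceleration c y ord0 k) = (fun y => - \sum_(i < n) \sum_(j < n)
    christoffel g c k i j y.1 * y.2 ord0 i * y.2 ord0 j)); last first.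
  by apply/funext => y; rewrite mxE.
apply: locally_lipschitzN; apply: locally_lipschitz_sum => i.
apply: locally_lipschitz_sum => j; apply: locally_lipschitzM.
  apply: locally_lipschitzM.
    apply: (locally_lipschitz_comp (f := fst) (g := christoffel g c k i j)).
      exact: locally_lipschitz_fst.
    exact: christoffel_locally_lipschitz.
  apply: (locally_lipschitz_comp (f := snd) (g := fun u : 'rV[R]_n => u ord0 i)).
    exact: locally_lipschitz_snd.
  exact: locally_lipschitz_coord.
apply: (locally_lipschitz_comp (f := snd) (g := fun u : 'rV[R]_n => u ord0 j)).
  exact: locally_lipschitz_snd.
exact: locally_lipschitz_coord.
Qed.

End Metric.

(** * Gronwall's inequality *)

Section Gronwall.
Context {R : realType}.

(** The function [expR (- K t) * phi t] is nonincreasing. *)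
Lemma gronwall_scalar (phi dphi : R -> R) (a b K : R) : a <= b ->
  (forall t, a <= t <= b -> is_derive t 1 phi (dphi t)) ->
  (forall t, a <= t <= b -> dphi t <= K * phi t) ->
  phi b <= expR (K * (b - a)) * phi a.
Proof.
move=> ab dp hK; pose lin : R -> R := (- K) *: id.
pose psi : R -> R := (expR \o lin) * phi.
have dpsi t : a <= t <= b ->
    is_derive t 1 psi (expR (- K * t) * dphi t + phi t * (expR (- K * t) * (- K))).
  move=> /dp dpt; have dl : is_derive t 1 lin (- K).
    have := is_deriveZ (- K) (is_derive_id t (1 : R)).
    by rewrite /GRing.scale/= mulr1.
  have de := is_derive1_comp (is_derive_expR (lin t)) dl.
  exact: is_deriveM de dpt.
have itv t : t \in `]a, b[%R -> a <= t <= b.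
  by rewrite in_itv/= => /andP[/ltW-> /ltW->].
have : psi b <= psi a.
  apply: (@ler0_derive1_nincr _ _ a b) => //.
  - by move=> t /itv/dpsi[].
  - move=> t /itv tab; have dt := dpsi t tab; rewrite derive1E derive_val.
    have := hK t tab; have := expR_gt0 (- K * t).
    set e := expR _ => e0 h; rewrite mulrCA -mulrDr pmulr_rle0//.
    by rewrite mulrN subr_le0 mulrC.
  - apply: derivable_within_continuous => t; rewrite in_itv/= => tab.
    by have [] := dpsi t tab.
rewrite /psi /lin /= -[(_ * _) b]/(expR (- K * b) * phi b) -[(_ * _) a]/(expR (- K * a) * phi a).
move=> h; have -> : phi b = expR (K * b) * (expR (- K * b) * phi b).
  by rewrite mulrA -expRD mulNr subrr expR0 mul1r.
rewrite mulrBr expRD -mulNr -mulrA.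
by rewrite ler_wpM2l ?expR_ge0.
Qed.

(** Vector version, for the sup norm: apply the scalar one to the sum of squares,
    which is differentiable and comparable with the square of the sup norm. *)
Lemma gronwall m (w dw : 'I_m -> R -> R) (a b L : R) : a <= b -> 0 <= L ->
  (forall i t, a <= t <= b -> is_derive t 1 (w i) (dw i t)) ->
  (forall i t s, a <= t <= b -> 0 <= s -> (forall j, `|w j t| <= s) -> `|dw i t| <= L * s) ->
  forall s, 0 <= s -> (forall j, `|w j a| <= s) ->
  forall j, `|w j b| <= Num.sqrt (expR (2 * L * m%:R * (b - a)) * m%:R) * s.
Proof.
move=> ab L0 dwt hL s s0 ws j.
pose phi : R -> R := \sum_(i < m) (w i * w i).
have phiE t : phi t = \sum_(i < m) w i t * w i t by rewrite /phi fct_sumE.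
have phi0 t : 0 <= phi t by rewrite phiE; apply: sumr_ge0 => i _; rewrite -expr2 sqr_ge0.
have wphi i t : w i t ^+ 2 <= phi t.
  rewrite phiE (bigD1 i)//= expr2 lerDl; apply: sumr_ge0 => k _.
  by rewrite -expr2 sqr_ge0.
have dphi t : a <= t <= b ->
    is_derive t 1 phi (\sum_(i < m) (w i t * dw i t + w i t * dw i t)).
  by move=> tab; apply: is_derive_sum => i; have dwi := dwt i t tab; exact: is_deriveM.
have := gronwall_scalar (K := 2 * L * m%:R) ab dphi.
have hK t : a <= t <= b ->
    \sum_(i < m) (w i t * dw i t + w i t * dw i t) <= 2 * L * m%:R * phi t.
  (* [r] bounds every [|w k t|], hence every [|dw k t|] up to the factor [L]. *)
move=> tab; pose r := Num.sqrt (phi t).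
  have wr k : `|w k t| <= r by rewrite -sqrtr_sqr ler_sqrt// wphi.
  have rr : r * r = phi t by rewrite -expr2 sqr_sqrtr.
  apply: (@le_trans _ _ (\sum_(i < m) 2 * L * phi t)); last first.
    by rewrite sumr_const card_ord -[leLHS]mulr_natl mulrCA -[leRHS]mulrA.
  apply: ler_sum => i _; rewrite -mulr2n -[leLHS]mulr_natl -[leRHS]mulrA ler_wpM2l//.
  rewrite (le_trans (ler_norm _))// normrM -rr mulrCA ler_pM// .
  by apply: hL => //; exact: sqrtr_ge0.
move=> /(_ hK) hb.
rewrite -(ler_pXn2r (n := 2)) ?nnegrE ?mulr_ge0 ?sqrtr_ge0//.
rewrite real_normK ?num_real// exprMn sqr_sqrtr ?mulr_ge0 ?expR_ge0//.
apply: le_trans (wphi j b) _; apply: (le_trans hb).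
rewrite -[leRHS]mulrA ler_wpM2l ?expR_ge0// phiE.
apply: (@le_trans _ _ (\sum_(i < m) s ^+ 2)); last first.
  by rewrite sumr_const card_ord mulr_natl.
apply: ler_sum => i _; rewrite -expr2 -[leLHS]real_normK ?num_real//.
by rewrite ler_pXn2r ?nnegrE.
Qed.

End Gronwall.

(** * Geodesics in charts *)

Section Geodesics.
Context {R : realType} {M : topologicalType} {n : nat}.
Variables (Atl : set (chart R M n)) (g : chart R M n -> M -> 'M[R]_n).
Hypothesis hA : smooth_atlas Atl.
Implicit Types (c d : chart R M n) (gam : R -> M).

Definition state c (t : R) gam : 'rV[R]_n * 'rV[R]_n :=
  (chart_map c (gam t), derive1 (chart_map c \o gam) t).

Section OneGeodesic.
Variables (gam : R -> M) (c : chart R M n) (t : R).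
Hypotheses (hgam : geodesic Atl g gam) (Ac : Atl c) (ct : chart_dom c (gam t)).

Let x := chart_map c \o gam.

Lemma position_differentiable : differentiable x t.
Proof. by have [_ /(_ c Ac)[s _]] := hgam; exact: (s [::] t ct). Qed.

Lemma velocity_differentiable : differentiable (derive1 x) t.
Proof.
have [_ /(_ c Ac)[s _]] := hgam; have := s [:: 1] t ct.
rewrite (_ : iter_derive _ _ = derive1 x)//.
by apply/funext => y; rewrite derive1E.
Qed.

Lemma position_is_derive i :
  is_derive t 1 (fun s => (state c s gam).1 ord0 i) ((state c t gam).2 ord0 i).
Proof.
have dx : derivable x t 1 by exact/diff_derivable/position_differentiable.
apply: DeriveDef; first by move/derivable_mxP : dx; exact.
by rewrite /= derive1E derive_mx// mxE.
Qed.

(** The geodesic equation, read as the second half of a first-order system. *)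
Lemma velocity_is_derive i :
  is_derive t 1 (fun s => (state c s gam).2 ord0 i)
    (acceleration g c (state c t gam) ord0 i).
Proof.
have dx : derivable (derive1 x) t 1 by exact/diff_derivable/velocity_differentiable.
apply: DeriveDef; first by move/derivable_mxP : dx; exact.
have [_ /(_ c Ac)[_ /(_ t ct i)]] := hgam; rewrite -/x.
move=> /eqP; rewrite addr_eq0 => /eqP e.
rewrite mxE -[RHS]e derive1nS derive1n1 derive1E derive_mx// mxE; congr ('D_1 _ t).
Qed.

Lemma state_continuous : {for t, continuous (fun s => state c s gam)}.
Proof.
have h1 : x s @[s --> t] --> x t.
  exact: differentiable_continuous position_differentiable.
have h2 : derive1 x s @[s --> t] --> derive1 x t.
  exact: differentiable_continuous velocity_differentiable.
exact: (cvg_pair h1 h2).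
Qed.

Lemma chart_dom_near : \forall s \near t, chart_dom c (gam s).
Proof.
have [cg _] := hgam; have [/(_ c Ac)[oc _ _ _ _] _ _] := hA.
exact: (cg t _ (open_near oc ct)).
Qed.

End OneGeodesic.

End Geodesics.

(** * Lipschitz dependence along a short interval and across charts *)

Section Chain.
Context {R : realType} {M : topologicalType} {n : nat}.
Variables (Atl : set (chart R M n)) (g : chart R M n -> M -> 'M[R]_n).
Hypothesis hA : smooth_atlas Atl.
Implicit Types (c d : chart R M n) (gam : R -> M).

(** The overlap is cut out of the open range of [c] by the continuous inverse of
    [c]. *)
Lemma open_overlap c d : Atl c -> Atl d ->
  open (chart_map c @` (chart_dom c `&` chart_dom d)).
Proof.
move=> Ac Ad; have [h _ _] := hA; have [oc orc cK _ ci] := h c Ac.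
have [od _ _ _ _] := h d Ad.
rewrite openE => _ [p [cp dp] <-]; rewrite /interior.
have rcp : chart_range c (chart_map c p) by exists p.
have := ci _ rcp (chart_dom d) => /(_ _)/wrap[].
  by rewrite cK//; exact: open_near.
move=> nd; apply: filterS2 (open_near orc rcp) nd => _ [q cq <-].
by rewrite /= cK// => dq; exists q.
Qed.

(** By the chain rule the change of charts acts on states by
    [(x, u) |-> (tau x, sum_l u_l d_l tau (x))], whose components are built from
    a smooth map and its first derivatives. *)
Lemma state_switch_sigma_lipschitz c d t : Atl c -> Atl d ->
  sigma_lipschitz [set gam | [/\ geodesic Atl g gam, chart_dom c (gam t) & chart_dom d (gam t)]]
    (state c t) (state d t).
Proof.
move=> Ac Ad; have [h _ hcd] := hA; have [oc orc cK _ ci] := h c Ac.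
have [sm _] := hcd c d Ac Ad; have oo := open_overlap Ac Ad.
set tau := transition c d in sm.
pose F (z : 'rV[R]_n * 'rV[R]_n) :=
  (tau z.1, \sum_(l < n) z.2 ord0 l *: 'D_(delta_mx ord0 l) tau z.1).
apply: (sigma_lipschitz_pointwise (F := F)).
- by apply: countably_meshed_prod; exact: countably_meshed_row.
- move=> gam [hgam cg dg]; rewrite /F /state; congr pair.
    by rewrite /= /tau /transition/= cK.
  have ox : (chart_map c @` (chart_dom c `&` chart_dom d)) (chart_map c (gam t)) by exists (gam t).
  have dtau : differentiable tau (chart_map c (gam t)) by exact: (sm [::]).
  have dx := position_differentiable hgam Ac cg.
  rewrite !derive1E.
  rewrite (@near_eq_derive _ _ _ (chart_map d \o gam) (tau \o (chart_map c \o gam))); last first.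
    apply: filterS (chart_dom_near hA hgam Ac cg) => s cs.
    by rewrite /tau /transition/= cK.
  rewrite deriveE; last exact: differentiable_comp.
  by rewrite diff_comp//= row_diffE// (deriveE _ dx).
- move=> gam [_ cg dg]; apply: locally_lipschitz_pointwise.
  have ox : (chart_map c @` (chart_dom c `&` chart_dom d)) (chart_map c (gam t)) by exists (gam t).
  apply: locally_lipschitz_pair.
    apply: locally_lipschitz_row => i.
    apply: (locally_lipschitz_comp (f := fst) (g := fun y => tau y ord0 i)).
      exact: locally_lipschitz_fst.
    exact: (smooth_on_entry_locally_lipschitz [::] ord0 i oo sm ox).
  apply: locally_lipschitz_row => i.
  rewrite (_ : (fun y => _) = (fun y : 'rV[R]_n * 'rV[R]_n =>
    \sum_(l < n) y.2 ord0 l * 'D_(delta_mx ord0 l) tau y.1 ord0 i)); last first.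
    by apply/funext => y; rewrite summxE; apply: eq_bigr => l _; rewrite mxE.
  apply: locally_lipschitz_sum => l; apply: locally_lipschitzM.
    apply: (locally_lipschitz_comp (f := snd) (g := fun u : 'rV[R]_n => u ord0 l)).
      exact: locally_lipschitz_snd.
    exact: locally_lipschitz_coord.
  apply: (locally_lipschitz_comp (f := fst) (g := fun y => 'D_(delta_mx ord0 l) tau y ord0 i)).
    exact: locally_lipschitz_fst.
  exact: (smooth_on_entry_locally_lipschitz [:: delta_mx ord0 l] ord0 i oo sm ox).
Qed.

(** Coordinates of a state, as a single family for use in Gronwall's inequality. *)
Definition coord2 (z : 'rV[R]_n * 'rV[R]_n) (j : 'I_(n + n)) : R :=
  match fintype.split j with inl i => z.1 ord0 i | inr i => z.2 ord0 i end.

Lemma coord2_normP (z z' : 'rV[R]_n * 'rV[R]_n) (s : R) : 0 <= s ->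
  `|z - z'| <= s <-> forall j, `|coord2 z j - coord2 z' j| <= s.
Proof.
move=> s0; rewrite prod_normE ge_max; split.
  move=> /andP[/row_normP-/(_ s0) h1 /row_normP-/(_ s0) h2] j; rewrite /coord2.
  by case: (fintype.split j) => i; [have := h1 i | have := h2 i]; rewrite !mxE.
move=> h; apply/andP; split; apply/row_normP => // i; rewrite !mxE.
  by have := h (lshift n i); rewrite /coord2; have /= -> := unsplitK (inl i : 'I_n + 'I_n).
by have := h (rshift n i); rewrite /coord2; have /= -> := unsplitK (inr i : 'I_n + 'I_n).
Qed.

(** The state of [gam] on [[a, b]] remains close to its initial value, around which
    the geodesic equation is [k]-Lipschitz on a ball of radius [1/(k+1)].  The
    closeness [1/(4(k+1))] leaves room for a second geodesic with almost the
    same initial state to remain in this ball as well. *)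
Definition tube c (k : nat) (a b : R) gam : Prop :=
  (forall y z, `|y - state c a gam| < k.+1%:R^-1 -> `|z - state c a gam| < k.+1%:R^-1 ->
     `|acceleration g c y - acceleration g c z| <= k%:R * `|y - z|) /\
  forall s, a <= s <= b -> chart_dom c (gam s) /\
    `|state c s gam - state c a gam| <= (4 * k.+1%:R)^-1.

Let lt_of_quarter (r x : R) : 0 < r -> x <= 4^-1 * r -> x < r.
Proof. lra. Qed.

Let lt_of_quarters (r x y : R) : 0 < r -> x <= 4^-1 * r -> y <= 4^-1 * r -> x + y < r.
Proof. lra. Qed.

(** Two geodesics in tubes with the same [k], whose initial states lie in the same
    cell of size [1/(4(k+1))], both stay within [1/(k+1)] of the initial state
    of the first one: the equation is [k]-Lipschitz between them and Gronwall's
    inequality applies. *)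
Lemma state_flow_sigma_lipschitz c k a b : Atl c -> a <= b ->
  sigma_lipschitz [set gam | geodesic Atl g gam /\ tube c k a b gam]
    (state c a) (state c b).
Proof.
move=> Ac ab.
have k4 : 0 < (4 * k.+1%:R)^-1 :> R by rewrite invr_gt0 mulr_gt0.
have [cell hcell] := countably_meshed_prod (@countably_meshed_row R n) (@countably_meshed_row R n) k4.
apply: (@sigma_lipschitz_cover _ _ nat _ _ _ (fun j => [set gam | [/\ geodesic Atl g gam,
   tube c k a b gam & cell (state c a gam) = j]])).
  by move=> gam [h1 h2]; exists (cell (state c a gam)).
move=> j.
(* The velocity component of the first-order system is 1-Lipschitz and the
   acceleration is [k]-Lipschitz; [L] bounds both constants. *)
pose L : R := k.+1%:R.
have kL : k%:R <= L by rewrite ler_nat.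
apply: (@lipschitz_sigma _ _ _ _ _ _ _ (Num.sqrt (expR (2 * L * (n + n)%:R * (b - a)) * (n + n)%:R))).
  exact: sqrtr_ge0.
move=> gam gam' [hgam [lip tu] cg] [hgam' [_ tu'] cg'].
have s0 : 0 <= `|state c a gam - state c a gam'| by [].
apply/coord2_normP; first by rewrite mulr_ge0// sqrtr_ge0.
pose w j t := coord2 (state c t gam) j - coord2 (state c t gam') j.
pose dw j t := coord2 ((state c t gam).2, acceleration g c (state c t gam)) j
   - coord2 ((state c t gam').2, acceleration g c (state c t gam')) j.
have near_a t : a <= t <= b -> `|state c t gam - state c a gam| < k.+1%:R^-1 /\
    `|state c t gam' - state c a gam| < k.+1%:R^-1.
  have [r rE] : exists r : R, r = k.+1%:R^-1 by exists (k.+1%:R^-1).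
  have q : (4 * k.+1%:R)^-1 = 4^-1 * r :> R by rewrite rE invfM.
  have kp : 0 < r by rewrite rE invr_gt0.
  move=> tab; have [_ h1] := tu t tab; have [_ h2] := tu' t tab.
  have h3 : `|state c a gam' - state c a gam| <= (4 * k.+1%:R)^-1.
    by apply: hcell; rewrite cg cg'.
  move: h1 h2 h3; rewrite -rE q => h1 h2 h3; split; first exact: lt_of_quarter h1.
  rewrite -(subrKA (state c a gam')); apply: le_lt_trans (ler_normD _ _) _.
  exact: lt_of_quarters h2 h3.
apply: (@gronwall _ _ w dw a b L) => //.
- move=> i t tab; rewrite /w /dw /coord2.
  have [ct _] := tu t tab; have [ct' _] := tu' t tab.
  case: (fintype.split i) => l; apply: is_deriveB.
  + exact: position_is_derive hgam Ac ct l.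
  + exact: position_is_derive hgam' Ac ct' l.
  + exact: velocity_is_derive hgam Ac ct l.
  + exact: velocity_is_derive hgam' Ac ct' l.
- move=> i t s tab s00 /coord2_normP-/(_ s00) hs.
  have [b1 b2] := near_a t tab; have := lip _ _ b1 b2.
  rewrite /dw; set z := state c t gam in hs *; set z' := state c t gam' in hs *.
  move=> hl; move: i; apply/coord2_normP; first by rewrite mulr_ge0.
  rewrite prod_normE ge_max/=; apply/andP; split.
    move: hs; rewrite prod_normE ge_max => /andP[_ /= h].
    by apply: (le_trans h); rewrite ler_peMl// ler1n.
  apply: (le_trans hl); exact: ler_pM (ler0n _ _) (normr_ge0 _) kL hs.
- by move=> i; move: i; apply/coord2_normP.
Qed.

End Chain.

(** * Lipschitz dependence up to time 1 *)

Section Flow.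
Context {R : realType} {M : topologicalType} {n : nat}.
Variables (Atl : set (chart R M n)) (g : chart R M n -> M -> 'M[R]_n).
Hypotheses (hA : smooth_atlas Atl) (hg : riemannian_metric Atl g).
Implicit Types (c d : chart R M n) (gam : R -> M).

Let add_lt (r e a b : R) : 0 < r -> 2 * r < e -> a < r -> b <= r / 8 -> a + b < e.
Proof. lra. Qed.

Let add_le (r a b : R) : 0 < r -> a <= r / 8 -> b <= r / 8 -> a + b <= r / 4.
Proof. lra. Qed.

Let shift_lt (s t u del : R) : s <= t + u -> u < del / 2 -> s - t < del / 2.
Proof. lra. Qed.

(** The tube condition has to hold at all times near [t] for the same [k], which
    makes it usable in a compactness argument.  The Lipschitz ball found at [t]
    is twice as large as required, and the state moves by at most an eighth
    of [1/(k+1)] around [t], hence by at most a quarter between two such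
    times. *)
Lemma tube_near c t gam : geodesic Atl g gam -> Atl c -> chart_dom c (gam t) ->
  exists k, \forall t' \near t & m \near \oo, tube g c k t' (t' + m.+1%:R^-1) gam.
Proof.
move=> hgam Ac ct.
have rct : chart_range c (state c t gam).1 by exists (gam t).
have [k0 [e [k00 e0 lip]]] :=
  locally_lipschitz_ball (acceleration_locally_lipschitz hA hg Ac rct).
pose k := maxn (Num.truncn k0).+1 (Num.truncn (2 / e)).+1.
have k0k : k0 <= k%:R.
  by apply/ltW/(lt_le_trans (truncnS_gt _)); rewrite ler_nat leq_maxl.
have [r rE] : exists r : R, r = k.+1%:R^-1 by exists (k.+1%:R^-1).
have r0 : 0 < r by rewrite rE invr_gt0.
have re : 2 * r < e.
  rewrite rE ltr_pdivrMr// mulrC -ltr_pdivrMr//.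
  apply: lt_le_trans (truncnS_gt _) _; rewrite ler_nat.
  by rewrite (leq_trans (leq_maxr (Num.truncn k0).+1 _))// leqW.
have r8 : 0 < r / 8 by rewrite divr_gt0.
have r4 : (4 * k.+1%:R)^-1 = r / 4 :> R by rewrite rE invfM mulrC.
have : \forall s \near t, chart_dom c (gam s) /\ `|state c t gam - state c s gam| <= r / 8.
  near=> s; split; near: s; first exact: (chart_dom_near hA hgam Ac ct).
  by have /cvgrPdist_le/(_ _ r8) := state_continuous hgam Ac ct.
move=> /nbhs_ballP[del /= del0 hdel].
have d2 : 0 < del / 2 by rewrite divr_gt0.
exists k; exists (ball t (del / 2), [set m | m.+1%:R^-1 < del / 2]) => /=.
  by split; [exact: nbhsx_ballx | exact: (near_infty_natSinv_lt (PosNum d2))].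
move=> [t' m] [/=]; rewrite -ball_normE/= => tt' m2.
have [_ ht'] : chart_dom c (gam t') /\ `|state c t gam - state c t' gam| <= r / 8.
  apply: hdel; rewrite -ball_normE/= (lt_le_trans tt')//.
  by rewrite [leRHS]splitr lerDl ltW.
split.
- move=> y z; rewrite -rE => hy hz.
  have hb v : `|v - state c t' gam| < r -> `|v - state c t gam| < e.
    move=> hv; rewrite -(subrKA (state c t' gam)) (le_lt_trans (ler_normD _ _))//.
    by rewrite [X in _ + X]distrC; exact: add_lt re hv ht'.
  apply: le_trans (lip y z (hb _ hy) (hb _ hz)) _.
  exact: ler_wpM2r (normr_ge0 _) _ _ k0k.
- move=> s /andP[s1 s2].
  have : ball t del s.
    rewrite -ball_normE/= -(subrKA t') (le_lt_trans (ler_normD _ _))// [ltRHS]splitr.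
    rewrite ltrD// distrC ger0_norm ?subr_ge0//; exact: shift_lt s2 m2.
  move=> /hdel[cs hs]; split=> //.
  rewrite -(subrKA (state c t gam)) r4; apply: le_trans (ler_normD _ _) _.
  by rewrite [X in X + _]distrC; exact: add_le r0 hs ht'.
Unshelve. all: by end_near. Qed.

Variables (cs : nat -> chart R M n) (idx : M -> nat).
Hypotheses (hcs : forall i, Atl (cs i)) (hidx : forall p, chart_dom (cs (idx p)) p).

(** The chart in which a state is read depends only on the current point, so that
    geodesics which pass through the same point are read in the same chart. *)
Definition local_state (t : R) gam := state (cs (idx (gam t))) t gam.

Definition tubular (a b : R) gam : Prop := exists i k, tube g (cs i) k a b gam.

(** Switch from the chart at [gam a] to the chart of the tube, follow the flow, and
    switch to the chart at [gam b]. *)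
Lemma local_state_step_sigma_lipschitz a b : a <= b ->
  sigma_lipschitz [set gam | geodesic Atl g gam /\ tubular a b gam]
    (local_state a) (local_state b).
Proof.
move=> ab; apply: (@sigma_lipschitz_cover _ _ (nat * nat * nat * nat)%type _ _ _
  (fun e => [set gam | [/\ geodesic Atl g gam, tube g (cs e.1.1.1) e.1.1.2 a b gam,
    idx (gam a) = e.1.2 & idx (gam b) = e.2]])).
  by move=> gam [h1 [i [k h2]]]; exists (i, k, idx (gam a), idx (gam b)).
move=> [[[i k] p] q] /=.
apply: (@sigma_lipschitz_eq _ _ _ _ _ (state (cs p) a) _ (state (cs q) b)).
- by move=> gam [_ _ <- _].
- by move=> gam [_ _ _ <-].
have tdom gam s : tube g (cs i) k a b gam -> a <= s <= b -> chart_dom (cs i) (gam s).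
  by move=> [_ h] /h[].
apply: (@sigma_lipschitz_trans _ _ _ _ _ _ _ (state (cs i) a)).
  apply: (sigma_lipschitz_sub _ (state_switch_sigma_lipschitz g hA a (hcs p) (hcs i))).
  by move=> gam [hg1 tg <- _]; split=> //; apply: tdom tg _; rewrite lexx.
apply: (@sigma_lipschitz_trans _ _ _ _ _ _ _ (state (cs i) b)).
  apply: (sigma_lipschitz_sub _ (state_flow_sigma_lipschitz g k (hcs i) ab)).
  by move=> gam [hg1 tg _ _].
apply: (sigma_lipschitz_sub _ (state_switch_sigma_lipschitz g hA b (hcs i) (hcs q))).
by move=> gam [hg1 tg _ <-]; split=> //; apply: tdom tg _; rewrite ab lexx.
Qed.

(** A Lebesgue number for the cover of [[0, 1]] by the neighbourhoods given by
    [tube_near]. *)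
Lemma tubular_subdivision gam : geodesic Atl g gam ->
  exists m : nat, forall t, 0 <= t <= 1 -> tubular t (t + m.+1%:R^-1) gam.
Proof.
move=> hgam.
have /compact_near_coveringP cov := @segment_compact R 0 1.
have := cov _ \oo (fun m t => tubular t (t + m.+1%:R^-1) gam) _.
case.
  move=> t _; have [k hk] := tube_near hgam (hcs _) (hidx (gam t)).
  by apply: filterS hk => -[t' m] /= h; exists (idx (gam t)), k.
move=> m _ /(_ m (leqnn m)) h; exists m => t t01; apply: h.
by rewrite /= in_itv.
Qed.

(** The geodesics are sorted by the number of intervals of a subdivision with
    tubes; for a fixed number the dependence is composed interval by interval. *)
Lemma local_state_sigma_lipschitz :
  sigma_lipschitz [set gam | geodesic Atl g gam] (local_state 0) (local_state 1).
Proof.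
pose E m := [set gam | geodesic Atl g gam /\
  forall t, 0 <= t <= 1 -> tubular t (t + m.+1%:R^-1) gam].
apply: (@sigma_lipschitz_cover _ _ nat _ _ _ E).
  by move=> gam hgam; have [m hm] := tubular_subdivision hgam; exists m.
move=> m.
have m0 : (0 : R) < m.+1%:R by [].
suff H j : (j <= m.+1)%N ->
    sigma_lipschitz (E m) (local_state 0) (local_state (j%:R / m.+1%:R)).
  by have := H m.+1 (leqnn _); rewrite divff// gt_eqF.
elim: j => [|j IH] jm.
  by rewrite mul0r; apply: (@lipschitz_sigma _ _ _ _ _ _ _ 1) => // x y _ _; rewrite mul1r.
apply: sigma_lipschitz_trans (IH (ltnW jm)) _.
have -> : j.+1%:R / m.+1%:R = j%:R / m.+1%:R + m.+1%:R^-1 :> R.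
  by rewrite -natr1 mulrDl mul1r.
apply: (sigma_lipschitz_sub _ (local_state_step_sigma_lipschitz _)).
  move=> gam [hgam h]; split=> //; apply: h.
  by rewrite divr_ge0// ler_pdivrMr// mul1r ler_nat ltnW.
by rewrite lerDl invr_ge0.
Qed.

End Flow.

(** Each set of a countable basis that lies in some chart domain selects one such
    chart.  The point [p0] provides a chart for the remaining indices. *)
Lemma countable_atlas {R : realType} {M : topologicalType} {n : nat}
    (Atl : set (chart R M n)) (p0 : M) : smooth_manifold Atl ->
  exists cs : nat -> chart R M n, (forall i, Atl (cs i)) /\
    forall p, exists i, chart_dom (cs i) p.
Proof.
move=> [_ [B cB [oB bB]] [hc hcov _]]; have [c0 Ac0 _] := hcov p0.
have /countable_injP[f finj] := cB.
have /choice[cs hcs] : forall i, exists c, Atl c /\ forall U, B U -> f U = i ->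
    (exists2 d, Atl d & U `<=` chart_dom d) -> U `<=` chart_dom c.
  move=> i; have [[U [BU fU [d Ad Ud]]]|no] := pselect (exists U, [/\ B U, f U = i &
      exists2 d, Atl d & U `<=` chart_dom d]).
    exists d; split=> // U' BU' fU' _.
    by have <- : U = U' by apply: finj; rewrite ?inE// fU fU'.
  by exists c0; split=> // U BU fU h; case: no; exists U.
exists cs; split=> [i|p]; first by have [] := hcs i.
have [c Ac cp] := hcov p; have [oc _ _ _ _] := hc c Ac.
have [U /= [BU Up] Uc] := bB p _ (open_near oc cp).
exists (f U); have [_ h] := hcs (f U); apply: (h U) => //.
by exists c.
Qed.

(** * Cylinders over a null set *)

Section MatrixVectors.
Context {R : realType}.

Lemma mxvec_normP p q (A : 'M[R]_(p, q)) (s : R) : 0 <= s ->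
  `|mxvec A| <= s <-> forall i, `|row i A| <= s.
Proof.
move=> s0; split=> [/row_normP-/(_ s0) h i|h].
  by apply/row_normP => // j; rewrite mxE -mxvecE.
apply/row_normP => // k; case/mxvec_indexP : k => i j.
by rewrite mxvecE; have /row_normP-/(_ s0 j) := h i; rewrite mxE.
Qed.

Lemma big_mxvec_index p q (F : 'I_(p * q) -> R) :
  \prod_k F k = \prod_(i < p) \prod_(j < q) F (mxvec_index i j).
Proof.
rewrite pair_bigA/= (reindex _ (curry_mxvec_bij p q))/=.
by apply: eq_bigr => -[i j].
Qed.

(** [Y * R^(nN)] is null: for each [b], multiply the boxes of a covering of [Y] by the
    cube [[-b, b]^(nN)]. *)
Lemma lebesgue_null_row_cylinder N n (Y : set 'rV[R]_n) :
  lebesgue_null Y ->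
  lebesgue_null [set w : 'rV[R]_(N.+1 * n) | Y (row ord0 (vec_mx w))].
Proof.
move=> Yn.
apply: (@lebesgue_null_countable_cover _ _ nat (fun b =>
   [set w : 'rV[R]_(N.+1 * n) | Y (row ord0 (vec_mx w)) /\ `|w| <= b%:R])).
  move=> w /= Yw; exists (Num.truncn `|w|).+1 => //=; split=> //.
  exact/ltW/truncnS_gt.
move=> b e e0; pose c : R := ((2 * b%:R) ^+ n) ^+ N.
have c0 : 0 <= c by rewrite !exprn_ge0// mulr_ge0.
have c1 : 0 < c + 1 by rewrite ltr_wpDl.
apply: (@coverable_sub _ _ _ _ _ _ _ (c * (e / (c + 1))) e (fun w h => h)).
  by rewrite mulrCA ger_pMr// ler_pdivrMr// mul1r lerDl.
apply: (coverable_transfer (rho := fun y w => y = row ord0 (vec_mx w)) c0 _ _ (Yn _ (divr_gt0 e0 c1))).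
- move=> [a d].
  pose ext (u : 'rV[R]_n) (z : R) : 'rV[R]_(N.+1 * n) :=
    mxvec (\matrix_(i, j) if i == ord0 then u ord0 j else z).
  exists (Some (ext a (- b%:R), ext d (2 * b%:R))); split.
    rewrite /= /boxvol/= big_mxvec_index big_ord_recl mulrC; apply: ler_pM => //.
    + by apply: prodr_ge0 => i _; apply: prodr_ge0.
    + by apply: prodr_ge0.
    + rewrite (eq_bigr (fun=> (2 * b%:R) ^+ n)); last first.
        move=> i _; rewrite (eq_bigr (fun=> 2 * b%:R)) ?prodr_const ?card_ord//.
        by move=> j _; rewrite mxvecE mxE/= ger0_norm// mulr_ge0.
      by rewrite prodr_const card_ord.
    + apply: ler_prod => j _; rewrite normr_ge0/= mxvecE mxE eqxx//.
  move=> y w _ [_ wb] ya yw k; case/mxvec_indexP : k => i j.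
  rewrite /= !mxE !mxvecE !mxE; case: eqP => [->|_].
    have := ya j; rewrite yw !mxE//.
  have /row_normP-/(_ (ler0n _ _) (mxvec_index i j)) := wb.
  rewrite ler_norml => /andP[h1 h2].
  rewrite h1 ger0_norm ?mulr_ge0//; lra.
- by move=> w [Yw _]; exists (row ord0 (vec_mx w)).
Qed.

End MatrixVectors.

(** * Tuples with a barycenter in a null set *)

Section Barycenters.
Context {R : realType} {M : topologicalType} {n N : nat}.
Variables (Atl : set (chart R M n)) (g : chart R M n -> M -> 'M[R]_n).
Hypotheses (hA : smooth_atlas Atl) (hg : riemannian_metric Atl g).
Variables (cs : nat -> chart R M n) (idx : M -> nat).
Hypotheses (hcs : forall i, Atl (cs i)) (hidx : forall p, chart_dom (cs (idx p)) p).
Variable A : set M.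

Let st := local_state cs idx.

(** The geodesics issued from a point of [A] along the vectors that make this point
    a barycenter of their endpoints. *)
Definition balanced_geodesics : set ('I_N.+1 -> R -> M) :=
  [set G | [/\ forall i, geodesic Atl g (G i), A (G ord0 0),
     forall i, G i 0 = G ord0 0 & \sum_i (st 0 (G i)).2 = 0]].

(** Row 0 holds the common starting point and row [i] the velocity of the [i]-th
    geodesic; the velocity of geodesic 0 is omitted, which makes the number of
    coordinates that of the tuple of endpoints. *)
Definition initial_data (G : 'I_N.+1 -> R -> M) : 'rV[R]_(N.+1 * n) :=
  mxvec (\matrix_(i < N.+1) if i == ord0 then (st 0 (G ord0)).1 else (st 0 (G i)).2).

Definition end_positions (G : 'I_N.+1 -> R -> M) : 'rV[R]_(N.+1 * n) :=
  mxvec (\matrix_(i < N.+1) (st 1 (G i)).1).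

(** The omitted velocity is minus the sum of the others, whence the factor. *)
Lemma initial_state_lipschitz i G G' :
  balanced_geodesics G -> balanced_geodesics G' ->
  `|st 0 (G i) - st 0 (G' i)| <= N.+1%:R * `|initial_data G - initial_data G'|.
Proof.
move=> [_ _ b1 s1] [_ _ b2 s2].
set s := `|_ - initial_data G'|; have s0 : 0 <= s by exact: normr_ge0.
have hs : forall k, `|row k (\matrix_(i < N.+1) (if i == ord0 then (st 0 (G ord0)).1 else (st 0 (G i)).2) -
  \matrix_(i < N.+1) (if i == ord0 then (st 0 (G' ord0)).1 else (st 0 (G' i)).2))| <= s.
  by apply/mxvec_normP => //; rewrite linearB.
have sN : s <= N.+1%:R * s by rewrite ler_peMl// ler1n.
have hu k : k != ord0 -> `|(st 0 (G k)).2 - (st 0 (G' k)).2| <= s.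
  by move=> k0; have := hs k; rewrite linearB/= !rowK (negbTE k0).
apply: pair_dist_le.
  have e (F : 'I_N.+1 -> R -> M) : F i 0 = F ord0 0 -> (st 0 (F i)).1 = (st 0 (F ord0)).1.
    by rewrite /st /local_state /state /= => ->.
  rewrite (e G (b1 i)) (e G' (b2 i)); have := hs ord0; rewrite linearB/= !rowK eqxx => h.
  exact: le_trans h sN.
have [->|i0] := eqVneq i ord0; last exact: le_trans (hu i i0) sN.
have e (F : 'I_N.+1 -> R -> M) : \sum_i (st 0 (F i)).2 = 0 -> (st 0 (F ord0)).2 = - \sum_(i | i != ord0) (st 0 (F i)).2.
  by rewrite (bigD1 ord0)//= => /eqP; rewrite addr_eq0 => /eqP.
rewrite (e G s1) (e G' s2) opprK addrC -sumrB (le_trans (ler_norm_sum _ _ _))//.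
apply: (@le_trans _ _ (\sum_(i < N.+1 | i != ord0) s)).
  by apply: ler_sum => k k0; rewrite distrC hu.
have -> : N.+1%:R * s = \sum_(k < N.+1) s by rewrite sumr_const card_ord mulr_natl.
by rewrite [leRHS](bigD1 ord0)//= lerDr.
Qed.

Lemma end_positions_sigma_lipschitz :
  sigma_lipschitz balanced_geodesics initial_data end_positions.
Proof.
apply: (sigma_lipschitz_family (f1 := fun i G => st 1 (G i))).
  move=> i; apply: (@sigma_lipschitz_trans _ _ _ _ _ _ _ (fun G => st 0 (G i))).
    by apply: (lipschitz_sigma (C := N.+1%:R)) => // G G'; exact: initial_state_lipschitz.
  apply: (sigma_lipschitz_pullback (h := fun G : 'I_N.+1 -> R -> M => G i) _
    (local_state_sigma_lipschitz hA hg hcs hidx)).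
  by move=> G [h _ _ _]; exact: h.
move=> G G' s _ _ s0 h; rewrite /end_positions -linearB; apply/mxvec_normP => // i.
rewrite linearB/= !rowK.
by have := h i; rewrite {1}prod_normE ge_max => /andP[].
Qed.

Lemma initial_data_lebesgue_null : volume_zero Atl A ->
  lebesgue_null (initial_data @` balanced_geodesics).
Proof.
move=> An; apply: (@lebesgue_null_countable_cover _ _ nat (fun k =>
   [set w | (chart_map (cs k) @` (chart_dom (cs k) `&` A)) (row ord0 (vec_mx w))])).
  move=> _ [G [_ AG _ _] <-]; exists (idx (G ord0 0)) => //=.
  by rewrite /initial_data mxvecK rowK eqxx; exists (G ord0 0).
move=> k; apply: lebesgue_null_row_cylinder; apply/lebesgue_outer_eq0; apply: An.
split; first by have [h _ _] := hA; exact: h.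
by move=> d Ad; have [_ _ h] := hA; exact: h.
Qed.

Lemma end_positions_lebesgue_null : volume_zero Atl A ->
  lebesgue_null (end_positions @` balanced_geodesics).
Proof.
move=> An; apply: lebesgue_null_image_sigma_lipschitz end_positions_sigma_lipschitz _.
exact: initial_data_lebesgue_null.
Qed.

Hypothesis hcomplete : geodesically_complete Atl g.

(** Completeness provides the geodesics whose endpoints are the exponentials. *)
Lemma barycenter_balanced_geodesics (Q : 'I_N.+1 -> M) p :
  barycenters Atl g Q p -> A p ->
  exists2 G, balanced_geodesics G & forall i, G i 1 = Q i.
Proof.
move=> [v [tv ev sv]] Ap.
have /choice[G hG] : forall i, exists gam, geodesic_from Atl g p (v i) gam /\ gam 1 = Q i.
  move=> i; have [gam0 hgam0] := hcomplete (tv i).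
  have : [set gam 1 | gam in geodesic_from Atl g p (v i)] (riem_exp Atl g p (v i)).
    by apply: xgetPex; exists (gam0 1); exists gam0.
  by rewrite ev => -[gam hgam gamQ]; exists gam.
have G0 i : G i 0 = p by have [[_ ? _] _] := hG i.
exists G; last by move=> i; have [] := hG i.
split.
- by move=> i; have [[]] := hG i.
- by rewrite G0.
- by move=> i; rewrite !G0.
- transitivity ((\sum_(i < N.+1) v i) (cs (idx p))); last by rewrite sv.
  rewrite fct_sumE; apply: eq_bigr => i _.
  have [[_ _ <-] _] := hG i.
  by rewrite /velocity /st /local_state /state/= !G0 asboolT.
Qed.

(** Tuples are sorted by the charts of their components; for a given choice of
    charts the coordinates of the tuple are those of [end_positions], and the
    transition to the chart [C] is differentiable on the overlap. *)
Lemma barycentric_tuples_volume_zero : volume_zero Atl A ->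
  volume_zero (prod_atlas (N := N.+1) Atl)
    [set Q : {ptws 'I_N.+1 -> M} | barycenters Atl g Q `&` A !=set0].
Proof.
move=> An C [_ hC]; apply/lebesgue_outer_eq0.
pose d (k : {ffun 'I_N.+1 -> nat}) := prod_chart (fun i => cs (k i)).
have Kd (k : {ffun 'I_N.+1 -> nat}) (Q : {ptws 'I_N.+1 -> M}) :
    chart_dom (d k) Q -> chart_inv (d k) (chart_map (d k) Q) = Q.
  move=> dQ; apply/funext => i; rewrite /d /prod_chart/= mxvecK rowK.
  by have [h _ _] := hA; have [_ _ hK _ _] := h _ (hcs (k i)); exact: hK (dQ i).
apply: (@lebesgue_null_countable_cover _ _ {ffun 'I_N.+1 -> nat} (fun k =>
  transition (d k) C @` ((end_positions @` balanced_geodesics) `&`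
    (chart_map (d k) @` (chart_dom C `&` chart_dom (d k)))))).
  move=> _ [Q [CQ [p [bp Ap]]] <-].
  have [G bG GQ] := barycenter_balanced_geodesics bp Ap.
  pose k := [ffun i => idx (Q i)].
  have dQ : chart_dom (d k) Q by move=> i; rewrite ffunE; exact: hidx.
  exists k => //; exists (chart_map (d k) Q); last first.
    by rewrite -[LHS]/(chart_map C (chart_inv (d k) (chart_map (d k) Q))) Kd.
  split; last by exists Q.
  exists G => //; rewrite /end_positions /d /=; congr mxvec.
  by apply/matrixP => i j; rewrite !mxE /k ffunE /st /local_state /state/= GQ.
move=> k; apply: lebesgue_null_image_differentiable.
  move=> x [_ ox]; have [|_ sm] := hC (d k) _; last exact: (sm [::]).
  by exists (fun i => cs (k i)).
by apply: lebesgue_null_sub (end_positions_lebesgue_null An) => x [].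
Qed.

End Barycenters.

Theorem theorem3p3 (R : realType) (n N : nat) (M : topologicalType)
    (Atl : set (chart R M n)) (g : chart R M n -> M -> 'M[R]_n)
    (hM : smooth_manifold Atl) (hconn : connected [set: M])
    (hg : riemannian_metric Atl g) (hcomplete : geodesically_complete Atl g)
    (hN : (1 <= N)%N)
    (A : set M) (hA : volume_zero Atl A) :
  volume_zero (prod_atlas (N := N) Atl)
    [set Q : {ptws 'I_N -> M} | barycenters Atl g Q `&` A !=set0].
Proof.
case: N hN => // N _.
(* An atlas can be indexed by the naturals only if it has a chart, hence the
   separate treatment of the empty manifold. *)
have [[p0 _]|noM] := pselect (exists p : M, True); last first.
  move=> C _; apply/lebesgue_outer_eq0 => e e0; exists (fun=> None); split.
    by move=> y [Q [_ [p _]] _]; case: noM; exists p.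
  by move=> k; rewrite big1// ltW.
have [cs [hcs /choice[idx hidx]]] := countable_atlas p0 hM.
have [_ _ sA] := hM.
exact: (barycentric_tuples_volume_zero sA hg hcs hidx hcomplete hA).
Qed.
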